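(* Let $n\ge 1$. Let $\mathfrak g\subset\hat{\mathcal X}(\mathbb{C}^n,0)$ be a solvable Lie algebra. Then $l(\mathfrak g)\le 2n$. Moreover the length $2n$ is attained for a Lie subalgebra of $\mathcal X(\mathbb{C}^n,0)$: there exists a solvable Lie subalgebra $\mathfrak g\subset\mathcal X(\mathbb{C}^n,0)$ with $l(\mathfrak g)=2n$.
   Context: Let $\mathfrak m$ be the maximal ideal of $\mathbb{C}[[x_1,\dots,x_n]]$. $\hat{\mathcal X}(\mathbb{C}^n,0)$ is the complex Lie algebra of formal vector fields $\sum_{j=1}^n a_j\,\partial/\partial x_j$ with $a_j\in\mathfrak m$ (singular at $0$), with the usual Lie bracket of derivations. $\mathcal X(\mathbb{C}^n,0)$ is the Lie subalgebra of those whose coefficients are convergent power series (germs of complex analytic vector fields singular at $0$). Lie subalgebras are complex Lie subalgebras. For a complex Lie algebra $\mathfrak g$, the derived series is $\mathfrak g^{(0)}=\mathfrak g$, $\mathfrak g^{(k+1)}=[\mathfrak g^{(k)},\mathfrak g^{(k)}]$ (the Lie subalgebra generated by the brackets); the soluble length is $l(\mathfrak g)=\min\{k\ge0:\mathfrak g^{(k)}=0\}$ (with $\min\emptyset=\infty$), and $\mathfrak g$ is solvable if $l(\mathfrak g)<\infty$. *)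

(* Defs.v *)
From HB Require Import structures.
From mathcomp Require Import all_boot all_order all_algebra.
From mathcomp Require Import finmap.
From mathcomp Require Import mathcomp_extra boolp classical_sets functions.
From mathcomp Require Import cardinality fsbigop reals constructive_ereal.
From mathcomp Require Import ereal esum.
From mathcomp Require Export complex.

Set Implicit Arguments.
Unset Strict Implicit.
Unset Printing Implicit Defensive.

Import Order.TTheory GRing.Theory Num.Theory.

Local Open Scope classical_set_scope.
Local Open Scope ring_scope.

(** [br] is the bracket of an ambient Lie algebra [V]; the definitions below
    use none of the Lie axioms. *)
Section LieAlgebra.
Context {K : nzRingType} {V : lmodType K} (br : V -> V -> V).

Definition lie_subalgebra (g : set V) : Prop :=
  [/\ g 0,
      forall u v, g u -> g v -> g (u + v),
      forall (c : K) u, g u -> g (c *: u)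
    & forall u v, g u -> g v -> g (br u v)].

Definition lie_generated (S : set V) : set V :=
  \bigcap_(h in [set h | lie_subalgebra h /\ S `<=` h]) h.

Fixpoint derived_series (g : set V) (k : nat) : set V :=
  if k is k'.+1 then
    lie_generated [set br u v | u in derived_series g k'
                              & v in derived_series g k']
  else g.

(** [min {k | g^(k) = 0}] with [min set0 = +oo].  The codomain is [\bar int]
    because [\bar nat] has no order in the library. *)
Definition soluble_length (g : set V) : \bar int :=
  match pselect (exists k, `[< derived_series g k = [set 0] >]) with
  | left ex_k => (ex_minn ex_k)%:Z%:E
  | right _ => +oo%E
  end.

Definition lie_solvable (g : set V) : Prop := (soluble_length g < +oo)%E.

End LieAlgebra.

(** [m] stands for the monomial [\prod_i x_i ^ (m i)]; addition of exponents
    is the pointwise one of [{ffun 'I_n -> nat}]. *)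
Definition mono (n : nat) : Type := {ffun 'I_n -> nat}.
HB.instance Definition _ n := Choice.on (mono n).
HB.instance Definition _ n := GRing.Nmodule.on (mono n).

Definition mono_var n (i : 'I_n) : mono n := [ffun j => (j == i) : nat].

(** A series is the family of its coefficients.  Only the pointwise vector
    space structure is inherited from functions, not the pointwise product. *)
Definition fps (K : nzRingType) (n : nat) : Type := mono n -> K.
HB.instance Definition _ (K : nzRingType) n :=
  GRing.Lmodule.copy (fps K n) (mono n -> K^o).

Section FormalVectorFields.
Variables (K : comNzRingType) (n : nat).
Implicit Types (f g : fps K n) (X Y : {ffun 'I_n -> fps K n}).

(** [fsbigop] sums are [0] by convention over an infinite support; the index
    set here is always finite. *)
Lemma finite_mono_splits (m : mono n) :
  finite_set [set p : mono n * mono n | p.1 + p.2 = m].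
Proof.
pose B := {ffun 'I_n -> 'I_(\sum_(i < n) m i)%N.+1}.
pose up (b : B) : mono n := [ffun i => b i : nat].
apply: (@sub_finite_set _ _ ((fun q : B * B => (up q.1, up q.2)) @` setT)).
  move=> -[p q] /= pq; pose dn (k : mono n) : B := [ffun i => inord (k i)].
  have pqi i : (p i + q i)%N = m i by rewrite -pq !ffunE.
  have le_m i : (m i <= \sum_(i < n) m i)%N by rewrite (bigD1 i) //= leq_addr.
  exists (dn p, dn q) => //=.
  congr (_, _); apply/ffunP => i; rewrite !ffunE inordK // ltnS.
    by rewrite (leq_trans _ (le_m i)) // -pqi leq_addr.
  by rewrite (leq_trans _ (le_m i)) // -pqi leq_addl.
by apply: finite_image; exact: finite_finset.
Qed.

Definition fps_mul f g : fps K n :=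
  fun m => \sum_(p \in [set p : mono n * mono n | p.1 + p.2 = m])
             f p.1 * g p.2.

Definition fps_partial (i : 'I_n) f : fps K n :=
  fun m => f (m + mono_var i) *+ (m i).+1.

Definition fps_maxideal : set (fps K n) := [set f | f 0 = 0].

(** [X : {ffun 'I_n -> fps K n}] stands for [\sum_j X j d/dx_j]. *)
Definition vf_apply X f : fps K n :=
  \sum_(i < n) fps_mul (X i) (fps_partial i f).

(** The [j]-th coefficient of the derivation [X \o Y - Y \o X] is its value at
    the [j]-th coordinate function. *)
Definition vf_bracket X Y : {ffun 'I_n -> fps K n} :=
  [ffun j => vf_apply X (Y j) - vf_apply Y (X j)].

Definition formal_singular_vf : set {ffun 'I_n -> fps K n} :=
  [set X | forall j, fps_maxideal (X j)].

End FormalVectorFields.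

Section ConvergentVectorFields.
Variables (R : realType) (n : nat).

(** A multi-indexed series has no preferred summation order, so convergence is
    absolute convergence, at every point of some polydisc around the origin. *)
Definition fps_convergent (f : fps R[i] n) : Prop :=
  exists2 r : R, 0 < r &
    forall x : 'I_n -> R[i], (forall i, Normc.normc (x i) < r) ->
      summable [set: mono n]
        (fun m => (Normc.normc (f m * \prod_(i < n) x i ^+ m i))%:E).

Definition convergent_singular_vf : set {ffun 'I_n -> fps R[i] n} :=
  [set X | formal_singular_vf X /\ forall j, fps_convergent (X j)].

End ConvergentVectorFields.

(* Main.v *)
From HB Require Import structures.
Require Import Defs.
From mathcomp Require Import all_boot all_order all_algebra.
From mathcomp Require Import finmap boolp classical_sets functions cardinality fsbigop.
From mathcomp Require Import reals constructive_ereal ereal esum.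
From mathcomp Require Import complex ring zify.

Set Implicit Arguments.
Unset Strict Implicit.
Unset Printing Implicit Defensive.
Import Order.TTheory GRing.Theory Num.Theory.
Local Open Scope classical_set_scope.
Local Open Scope ring_scope.

(** Upper bound.  Let K be the field of fractions of C[[x_1, .., x_n]].  A
    formal vector field is a vector of K^n, and a solvable Lie algebra g of
    fields is studied through a chain 0 = V_0 < V_1 < .. of K-subspaces of K^n,
    each stable under [g, _] and spanned by fields of g.  There are at most n
    steps, so it is enough that each step absorbs two terms of the derived
    series: with I = g :&: V_(i+1), the second derived algebra of I must lie in
    V_i.

    To pass from V to the next subspace, choose an ideal h of g with h not in V
    and [h, h] in V (the last term of the derived series of g outside V is
    one), such that W = V + K h has least dimension; take W as next subspace.
    A basis of W modulo V made of fields x_i of h gives coordinates.  The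
    coordinates of a field of h are constants for all the derivations in W,
    because [h, h] is contained in V and V is spanned by fields of g.
    Consequently a field y of I acts on h modulo V by a matrix T(y)
    ([coord_ad]), T turns brackets into commutators ([ad_mxB]), and fields with
    T = 0 commute modulo V ([ad_mx0_abelian]), since their own coordinates are
    constant as well.  So everything reduces to T(I) being commutative
    ([ad_mx_commutative]).

    Minimality of W replaces the irreducibility hypothesis in the proof of
    Lie's theorem.  If an ideal J of g has commuting nilpotent matrices, the
    fields of h killed by J modulo V form an ideal of the same kind as h; it is
    not contained in V, hence spans W, and T(J) = 0 ([ad_mx_nilpotent_ideal]).
    If A is the last term of the derived series of I on which T does not
    vanish, and A is not I itself, this applies first to [I, A] and then to A:
    a sum x of commutators [m_i, a_i] where x commutes with each a_i has
    tr(x^k) = 0 for all k > 0, hence is nilpotent.  Thus T(A) = 0, a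
    contradiction.

    Sharpness.  The fields sum_j (a_j x_j + b_j x_j^2) d/dx_j, with a_j and b_j
    polynomials in x_1, .., x_(j-1), form a solvable Lie algebra; in the
    coordinates -1/x_j they are affine in each variable over the previous
    ones.  Two steps of the derived series kill one variable
    ([affine_derived]).  Conversely the 2j-th term still contains all
    x^m d/dx_k with k > j, m_k = 1 or 2, m_i = 0 for i > k and m_i large for
    i < k ([derived_monom]), and one more step in the last variable leaves a
    nonzero multiple of x_n^2 d/dx_n. *)

(** * Matrices whose powers have trace zero *)

Lemma mxtrace_idempotent (F : fieldType) m (e : 'M[F]_m) :
  e *m e = e -> \tr e = (\rank e)%:R.
Proof.
move=> ee; have eE := mulmx_base e.
have RC1 : row_base e *m col_base e = 1%:M.
  apply: (row_full_inj (col_base_full e)); apply: (row_free_inj (row_base_free e)).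
  by rewrite /= mulmx1 mulmxA eE -mulmxA eE.
by rewrite -{1}eE mxtrace_mulC RC1 mxtrace1.
Qed.

(** Fitting decomposition: the projection [e] onto the part where [A] is
    invertible along the nilpotent part is a polynomial in [A] without constant
    term.  Its trace is then zero by hypothesis, while it is also the rank of
    [e]; in characteristic 0 this forces [e = 0]. *)
Lemma nilpotent_of_traces (F : fieldType) m (A : 'M[F]_m) :
  (forall k, k.+1%:R != 0 :> F) ->
  (forall k, \tr (A ^+ k.+1) = 0) -> exists k, A ^+ k = 0.
Proof.
case: m A => [|m] A char0 trA; first by exists 0; rewrite flatmx0 [RHS]flatmx0.
have [s [q q0 pE]] := multiplicity_XsubC (char_poly A) 0.
have {}q0 : ~~ root q 0 by rewrite monic_neq0 ?char_poly_monic in q0.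
rewrite subr0 in pE.
(* The exponent [s.+1] instead of [s] makes the polynomial defining [e]
   divisible by 'X even when [A] is invertible. *)
have : coprimep ('X ^+ s.+1) q by rewrite coprimep_expl // coprimep_sym coprimepX.
case/Bezout_eq1_coprimepP => -[u v] /= uv.
exists s.+1.
have [e eE] : {e | e = horner_mx A (u * 'X^(s.+1))} by eexists.
have CH p : horner_mx A (p * (q * 'X^s)) = 0.
  by rewrite rmorphM -pE /= Cayley_Hamilton mulr0.
have vqE : v * q = 1 - u * 'X^(s.+1) by rewrite -uv; ring.
have eAs : A ^+ s.+1 = e * A ^+ s.+1.
  rewrite -[in LHS](horner_mx_X A) -[in RHS](horner_mx_X A) eE.
  rewrite -!rmorphXn -rmorphM.
  apply/eqP; rewrite -subr_eq0 -rmorphB /=.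
  rewrite (_ : _ - _ = (v * 'X) * (q * 'X^s)) ?CH //.
  have -> : v * 'X * (q * 'X^s) = (v * q) * ('X * 'X^s) by ring.
  by rewrite vqE -exprS; ring.
have ee : e *m e = e.
  apply/eqP; rewrite -subr_eq0 eE -[X in X - _](rmorphM (horner_mx A)) -rmorphB /=.
  rewrite (_ : _ - _ = (- u * v * 'X) * (q * 'X^s)) ?CH //.
  have -> : - u * v * 'X * (q * 'X^s) = - u * (v * q) * ('X * 'X^s) by ring.
  by rewrite vqE -exprS; ring.
have : \tr e = 0.
  rewrite eE -[u]coefK poly_def mulr_suml rmorph_sum raddf_sum big1 //= => i _.
  rewrite -scalerAl -exprD linearZ rmorphXn /= horner_mx_X addnS.
  by rewrite mxtraceZ trA mulr0.
rewrite (mxtrace_idempotent ee) => rk0.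
have e0 : e = 0.
  apply/eqP; rewrite -mxrank_eq0.
  by case: (\rank e) rk0 => // k /eqP; rewrite (negPf (char0 k)).
by rewrite eAs e0 mul0r.
Qed.

(** * Bases modulo a subspace and common kernels *)

(** [S] is an arbitrary set, seen through [phi]; it need not be a subspace.
    Used for ideals of vector fields, and for the matrices by which an ideal
    acts. *)
Lemma exists_family_mod (K : fieldType) n (T : Type) (S : set T)
    (phi : T -> 'rV[K]_n) (V : 'M[K]_n) :
  exists k (x : 'I_k -> T), [/\ forall i, S (x i),
    \rank (V + \matrix_i phi (x i))%MS = (\rank V + k)%N
  & forall u, S u -> (phi u <= V + \matrix_i phi (x i))%MS].
Proof.
have [m] := ubnP (n - \rank V); elim: m => // m IHm in V *.
have [all_in|] := pselect (forall u, S u -> (phi u <= V)%MS).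
  move=> _; exists 0%N, (fun i : 'I_0 => False_rect T (notF (ltn_ord i))).
  split=> [[]//||u Su]; last by rewrite (submx_trans (all_in u Su)) ?addsmxSl.
  by rewrite (flatmx0 (\matrix_i _)) addsmx0 addn0.
case/existsNP => u /not_implyP[Su /negP uV] ltm.
have VV' : (V < V + phi u)%MS by rewrite /ltmx addsmxSl addsmx_sub submx_refl uV.
have rkV' : \rank (V + phi u)%MS = (\rank V).+1.
  apply/eqP; rewrite eqn_leq rank_ltmx // andbT.
  by rewrite (leq_trans (mxrank_adds_leqif _ _)) // -[X in (_ <= X)%N]addn1 leq_add2l rank_leq_row.
have [|k [x [Sx rkx inx]]] := IHm (V + phi u)%MS.
  have := rank_leq_col (V + phi u)%MS; rewrite rkV' => lt_n.
  by rewrite -ltnS (leq_trans _ ltm) // ltnS subnS prednK // subn_gt0.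
pose y (i : 'I_(1 + k)) := if fintype.split i is inr j then x j else u.
have yE : \matrix_i phi (y i) = col_mx (phi u) (\matrix_i phi (x i)).
  apply/matrixP => i j; rewrite !mxE /y.
  by case: (fintype.split i) => i'; rewrite ?mxE // ord1.
have eqVy : (V + \matrix_i phi (y i) :=: V + phi u + \matrix_i phi (x i))%MS.
  apply/eqmxP; rewrite yE -addsmxA.
  by rewrite !(addsmxS (submx_refl V)) ?addsmxE.
exists (1 + k)%N, y; split=> [i||w Sw].
- by rewrite /y; case: (fintype.split i).
- by rewrite eqVy rkx rkV' addnS.
- by rewrite eqVy inx.
Qed.

(** If the rows of [B] are a basis of [V + B] modulo [V], then [w *m P] is the
    vector of coordinates of [w] modulo [V]. *)
Lemma exists_coordinates_mod (K : fieldType) n k (V : 'M[K]_n) (B : 'M[K]_(k, n)) :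
  \rank (V + B)%MS = (\rank V + k)%N ->
  exists P : 'M[K]_(n, k), [/\ B *m P = 1%:M, V *m P = 0
    & forall w : 'rV_n, (w <= V + B)%MS -> (w - w *m P *m B <= V)%MS].
Proof.
move=> rkVB; pose Q := cokermx V.
have freeBQ : row_free (B *m Q).
  have := mxrank_mul_ker (V + B)%MS Q.
  rewrite (_ : \rank (_ *m Q) = \rank (B *m Q)); last first.
    by rewrite addsmxMr mulmx_coker addsmxC addsmx0.
  rewrite rkVB => rkE; rewrite /row_free eqn_leq rank_leq_row /=.
  rewrite -(leq_add2l (\rank V)) -rkE addnC leq_add2r mxrankS //.
  by rewrite submxE -sub_kermx capmxSr.
have BQV : B *m Q *m pinvmx (B *m Q) = 1%:M by exact: mulmxVp.
exists (Q *m pinvmx (B *m Q)); split.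
- by rewrite mulmxA.
- by rewrite mulmxA mulmx_coker mul0mx.
- move=> w /sub_addsmxP[u ->].
  rewrite mulmxA mulmxDl -[u.1 *m V *m Q]mulmxA mulmx_coker mulmx0 add0r.
  by rewrite -!(mulmxA u.2) BQV mul1mx addrK submxMl.
Qed.

(** The kernel vector must be found inside [S], which is only closed under the
    given matrices: it is obtained from a vector of [S] by applying each matrix
    in turn as often as the result stays nonzero. *)
Lemma common_kernel_of_commuting_nilpotents (K : fieldType) d
    (S : set 'rV[K]_d) (s : seq 'M[K]_d) :
  {in s &, forall a b, a *m b = b *m a} ->
  {in s, forall a, exists k, a ^+ k = 0} ->
  (forall v, {in s, forall a, S v -> S (v *m a)}) ->
  (exists2 v, S v & v != 0) ->
  exists v, [/\ S v, v != 0 & {in s, forall a, v *m a = 0}].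
Proof.
elim: s => [|a s IHs] comm nilp stab [v Sv v0]; first by exists v; split.
have {IHs}[|||w [Sw w0 ws]] := IHs _ _ _ (ex_intro2 _ _ v Sv v0).
- by move=> b c bs cs; apply: comm; rewrite inE ?bs ?cs orbT.
- by move=> b bs; apply: nilp; rewrite inE bs orbT.
- by move=> u b bs; apply: stab; rewrite inE bs orbT.
have exk : exists k, w *m a ^+ k == 0.
  by have [k ak] := nilp a (mem_head _ _); exists k; rewrite ak mulmx0.
case: (ex_minnP exk) => -[|k] /eqP wk kmin.
  by rewrite expr0 mulmx1 in wk; rewrite wk eqxx in w0.
exists (w *m a ^+ k); split.
- elim: {wk kmin} k => [|k IHk]; first by rewrite expr0 mulmx1.
  by rewrite exprSr mulmxA; apply: stab => //; exact: mem_head.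
- by apply/negP => /kmin; rewrite ltnn.
- move=> b; rewrite inE => /predU1P[->|bs]; first by rewrite -mulmxA -[_ *m a]exprSr.
  have com : GRing.comm (a ^+ k) b.
    by apply/esym/commrX; apply: comm; rewrite inE ?eqxx ?bs ?orbT.
  by rewrite -mulmxA -[_ *m b]/(_ * b) com mulmxA ws // mul0mx.
Qed.

(** * Ideals and derived series *)

Record lie_axioms (C : nzRingType) (L : lmodType C) (br : L -> L -> L) : Prop := {
  lieDr : forall u v w, br u (v + w) = br u v + br u w;
  lieZr : forall c u v, br u (c *: v) = c *: br u v;
  lieC : forall u v, br u v = - br v u;
  lieJ : forall u v w, br u (br v w) = br (br u v) w + br v (br u w) }.

Definition lie_ideal (C : nzRingType) (L : lmodType C) (br : L -> L -> L)
    (g h : set L) : Prop :=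
  [/\ lie_subalgebra br h, h `<=` g & forall z u, g z -> h u -> h (br z u)].

Section LieSubalgebras.
Variables (C : nzRingType) (L : lmodType C) (br : L -> L -> L).
Hypothesis brP : lie_axioms br.
Implicit Types (S g h : set L) (u v w z : L).

Let brDr := lieDr brP.
Let brZr := lieZr brP.
Let brC := lieC brP.
Let brJ := lieJ brP.

Lemma lieDl u v w : br (u + v) w = br u w + br v w.
Proof. by rewrite brC brDr opprD -!brC. Qed.

Lemma lieZl c u w : br (c *: u) w = c *: br u w.
Proof. by rewrite brC brZr -scalerN -brC. Qed.

Lemma lie0r u : br u 0 = 0.
Proof. by apply: (addrI (br u 0)); rewrite -brDr !addr0. Qed.

Lemma lie_generatedS S : S `<=` lie_generated br S.
Proof. by move=> u Su h [_]; apply. Qed.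

Lemma lie_generated_min S h :
  lie_subalgebra br h -> S `<=` h -> lie_generated br S `<=` h.
Proof. by move=> hP Sh u; apply. Qed.

Lemma lie_generated_subalgebra S : lie_subalgebra br (lie_generated br S).
Proof.
split=> [h [[]]//|u v Su Sv h [hP Sh]|c u Su h [hP Sh]|u v Su Sv h [hP Sh]].
- by case: (hP) => _ + _ _; apply; [exact: Su|exact: Sv].
- by case: (hP) => _ _ + _; apply; exact: Su.
- by case: (hP) => _ _ _; apply; [exact: Su|exact: Sv].
Qed.

Lemma derived_seriesS_min g k h : lie_subalgebra br h ->
  (forall u v, derived_series br g k u -> derived_series br g k v -> h (br u v)) ->
  derived_series br g k.+1 `<=` h.
Proof.
by move=> hP hh; apply: lie_generated_min => // _ [u gu [v gv <-]]; exact: hh.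
Qed.

Lemma derived_series_bracket g k u v : derived_series br g k u ->
  derived_series br g k v -> derived_series br g k.+1 (br u v).
Proof. by move=> gu gv; apply: lie_generatedS; exists u => //; exists v. Qed.

Lemma derived_series_subalgebra g k :
  lie_subalgebra br g -> lie_subalgebra br (derived_series br g k).
Proof. by case: k => // k _; exact: lie_generated_subalgebra. Qed.

Lemma derived_series_decr g j k : lie_subalgebra br g -> (j <= k)%N ->
  derived_series br g k `<=` derived_series br g j.
Proof.
move=> gP; elim: k => [|k IHk]; first by rewrite leqn0 => /eqP->.
rewrite leq_eqVlt => /predU1P[->//|/IHk kj]; apply: subset_trans kj.
have kP := derived_series_subalgebra k gP.
by apply: derived_seriesS_min => //; case: kP.
Qed.

Lemma derived_seriesSS g h k : h `<=` g ->
  derived_series br h k `<=` derived_series br g k.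
Proof.
move=> hg; elim: k => // k IHk.
apply: derived_seriesS_min; first exact: lie_generated_subalgebra.
by move=> u v /IHk gu /IHk gv; exact: derived_series_bracket.
Qed.

Lemma lie_generated_ideal g S : lie_subalgebra br g -> S `<=` g ->
  (forall z s, g z -> S s -> lie_generated br S (br z s)) ->
  lie_ideal br g (lie_generated br S).
Proof.
move=> gP Sg adS; have SP := lie_generated_subalgebra S.
split=> //; first exact: lie_generated_min.
suff sub : lie_generated br S `<=` [set u | lie_generated br S u /\
    forall z, g z -> lie_generated br S (br z u)].
  by move=> z u gz /sub[_]; apply.
case: (SP) => S0 SD SZ SB.
apply: lie_generated_min; last first.
  by move=> s Ss; split=> [|z gz]; [exact: lie_generatedS|exact: adS].
split=> [|u v [Su adu] [Sv adv]|c u [Su adu]|u v [Su adu] [Sv adv]].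
- by split=> // z _; rewrite lie0r.
- split=> [|z gz]; first exact: SD.
  by rewrite brDr; apply: SD; [exact: adu|exact: adv].
- split=> [|z gz]; first exact: SZ.
  by rewrite brZr; apply: SZ; exact: adu.
- split=> [|z gz]; first exact: SB.
  by rewrite brJ; apply: SD; apply: SB => //; [exact: adu|exact: adv].
Qed.

Lemma lie_ideal_bracket g h1 h2 : lie_subalgebra br g ->
  lie_ideal br g h1 -> lie_ideal br g h2 ->
  lie_ideal br g (lie_generated br [set br u v | u in h1 & v in h2]).
Proof.
move=> gP [_ h1g h1ad] [_ h2g h2ad].
apply: lie_generated_ideal; first exact: gP.
  move=> _ [u hu [v hv <-]].
  by case: gP => _ _ _; apply; [exact: h1g|exact: h2g].
move=> z _ gz [u hu [v hv <-]].
case: (lie_generated_subalgebra [set br u v | u in h1 & v in h2]) => _ genD _ _.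
rewrite brJ; apply: genD; apply: lie_generatedS.
  by exists (br z u); [exact: h1ad|exists v].
by exists u => //; exists (br z v) => //; exact: h2ad.
Qed.

Lemma derived_series_ideal g h k : lie_subalgebra br g ->
  lie_ideal br g h -> lie_ideal br g (derived_series br h k).
Proof.
move=> gP hI; elim: k => [|k kI]; first exact: hI.
exact: (lie_ideal_bracket gP kI kI).
Qed.

End LieSubalgebras.

(** * Solvable Lie algebras of derivations of a field *)

(** [vf_act] and [vf_br] are the action and the Lie bracket of the vector
    fields [\sum_i w 0 i * D i] over the field [K].  The Lie algebra [L] over
    [C] is embedded into these fields by [phi]; the derived series is taken
    in [L], over [C], and linear algebra takes place in [K^n]; [iota] relates
    the two kinds of scalars. *)
Section VectorFields.
Variables (C : nzRingType) (L : lmodType C) (br : L -> L -> L).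
Hypothesis brP : lie_axioms br.
Variables (K : fieldType) (n : nat) (D : 'I_n -> K -> K).
Hypothesis char0 : forall k, k.+1%:R != 0 :> K.
Hypothesis DD : forall i, {morph D i : x y / x + y}.
Hypothesis DM : forall i x y, D i (x * y) = D i x * y + x * D i y.

Definition vf_act (w : 'rV[K]_n) (x : K) : K := \sum_i w 0 i * D i x.

Definition vf_br (u w : 'rV[K]_n) : 'rV[K]_n :=
  \row_j (vf_act u (w 0 j) - vf_act w (u 0 j)).

Variables (iota : C -> K) (phi : L -> 'rV[K]_n).
Hypothesis phiD : {morph phi : u v / u + v}.
Hypothesis phiZ : forall c u, phi (c *: u) = iota c *: phi u.
Hypothesis phi_inj : forall u, phi u = 0 -> u = 0.
Hypothesis phi_br : forall u v, phi (br u v) = vf_br (phi u) (phi v).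

Implicit Types (u v w z : L) (g h J : set L) (V W : 'M[K]_n).

Lemma phi0 : phi 0 = 0.
Proof. by apply: (addrI (phi 0)); rewrite -phiD !addr0. Qed.

Lemma phiN u : phi (- u) = - phi u.
Proof. by apply: (addrI (phi u)); rewrite -phiD !subrr phi0. Qed.

Lemma vf_actD a x y : vf_act a (x + y) = vf_act a x + vf_act a y.
Proof. by rewrite -big_split; apply: eq_bigr => i _; rewrite DD mulrDr. Qed.

Lemma vf_act0 a : vf_act a 0 = 0.
Proof. by apply: (addrI (vf_act a 0)); rewrite -vf_actD !addr0. Qed.

Lemma vf_actM a x y : vf_act a (x * y) = vf_act a x * y + x * vf_act a y.
Proof.
rewrite mulr_suml mulr_sumr -big_split; apply: eq_bigr => i _.
by rewrite DM /=; ring.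
Qed.

Lemma vf_act_sum a k (x : 'I_k -> K) :
  vf_act a (\sum_i x i) = \sum_i vf_act a (x i).
Proof. by apply: (big_morph (vf_act a)) => [x' y|]; rewrite ?vf_actD ?vf_act0. Qed.

Lemma vf_actDl a b x : vf_act (a + b) x = vf_act a x + vf_act b x.
Proof. by rewrite -big_split; apply: eq_bigr => i _; rewrite mxE mulrDl. Qed.

Lemma vf_actZl c a x : vf_act (c *: a) x = c * vf_act a x.
Proof. by rewrite mulr_sumr; apply: eq_bigr => i _; rewrite mxE mulrA. Qed.

Lemma vf_act_comb k (c : 'rV[K]_k) (B : 'M[K]_(k, n)) x :
  vf_act (c *m B) x = \sum_i c 0 i * vf_act (row i B) x.
Proof.
rewrite mulmx_sum_row.
rewrite (big_morph (vf_act^~ x) (id1 := 0) (op1 := +%R)) => [|a b|]; first last.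
- by rewrite /vf_act big1 // => i _; rewrite mxE mul0r.
- exact: vf_actDl.
by apply: eq_bigr => i _; rewrite vf_actZl.
Qed.

Lemma vf_brDr (z a b : 'rV_n) : vf_br z (a + b) = vf_br z a + vf_br z b.
Proof. by apply/rowP => j; rewrite !mxE vf_actD vf_actDl /=; ring. Qed.

Lemma vf_br_comb z k (c : 'rV[K]_k) (x : 'I_k -> L) :
  vf_br (phi z) (c *m \matrix_i phi (x i)) =
  map_mx (vf_act (phi z)) c *m (\matrix_i phi (x i))
    + c *m \matrix_i phi (br z (x i)).
Proof.
apply/rowP => j; rewrite !mxE vf_act_sum vf_act_comb -sumrB -big_split /=.
apply: eq_bigr => i _.
by rewrite vf_actM rowK !mxE phi_br !mxE /=; ring.
Qed.

Definition vf_stable g V := forall z (w : 'rV[K]_n),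
  g z -> (w <= V)%MS -> (vf_br (phi z) w <= V)%MS.

(** A consequence of [V] being spanned over [K] by [g :&: V], in dual form:
    a function constant along the fields of [g] in [V] is constant along all of
    [V]. *)
Definition vf_spanned g V := forall x : K,
  (forall u, g u -> (phi u <= V)%MS -> vf_act (phi u) x = 0) ->
  forall v : 'rV[K]_n, (v <= V)%MS -> vf_act v x = 0.

Lemma phi_sub_subalgebra g V : lie_subalgebra br g -> vf_stable g V ->
  lie_subalgebra br [set u | g u /\ (phi u <= V)%MS].
Proof.
case=> g0 gD gZ gB stV; split=> [|u v [gu uV] [gv vV]|c u [gu uV]|u v [gu uV] [gv vV]].
- by split=> //; rewrite phi0 sub0mx.
- by split; [exact: gD|rewrite phiD addmx_sub].
- by split; [exact: gZ|rewrite phiZ scalemx_sub].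
- by split; [exact: gB|rewrite phi_br stV].
Qed.

Lemma phi_sub_ideal g V : lie_subalgebra br g -> vf_stable g V ->
  lie_ideal br g [set u | g u /\ (phi u <= V)%MS].
Proof.
move=> gP stV; split; [exact: phi_sub_subalgebra|by move=> u []|].
move=> z u gz [gu uV]; split; last by rewrite phi_br stV.
by case: gP => _ _ _; apply.
Qed.

(** The candidates for the ideal that produces the next subspace of the
    chain. *)
Definition abelian_mod g V h :=
  [/\ lie_ideal br g h, exists2 w, h w & ~~ (phi w <= V)%MS
    & forall u v, h u -> h v -> (phi (br u v) <= V)%MS].

Section Step.
Variables (g : set L) (V : 'M[K]_n) (N : nat).
Hypothesis gP : lie_subalgebra br g.
Hypothesis g_sol : derived_series br g N `<=` [set 0].
Hypothesis stV : vf_stable g V.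
Hypothesis spV : vf_spanned g V.

(** The last term of the derived series of [g] that is not contained in [V]
    is such an ideal. *)
Lemma exists_abelian_mod : (exists2 w, g w & ~~ (phi w <= V)%MS) ->
  exists h, abelian_mod g V h.
Proof.
move=> gV; pose out k := `[< exists2 w, derived_series br g k w & ~~ (phi w <= V)%MS >].
have out_bound k : out k -> (k <= N)%N.
  move=> /asboolP[w kw]; apply: contraNleq => /ltnW Nk.
  by rewrite (g_sol (derived_series_decr gP Nk kw)) phi0 sub0mx.
have [q /asboolP qout qmax] := ex_maxnP (ex_intro out 0 (asboolT gV)) out_bound.
exists (derived_series br g q); split=> //.
  apply: derived_series_ideal => //; split=> //.
  by case: gP.
move=> u v qu qv; apply/negPn/negP => uvV.
have /qmax : out q.+1 by apply/asboolP; exists (br u v) => //; exact: derived_series_bracket.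
by rewrite ltnn.
Qed.

(* From here on [W] is the candidate for the next subspace, the rows of [B] are
   a basis of [W] modulo [V] that consists of fields of [h], and [P] computes
   coordinates in that basis. *)
Variables (h : set L) (k : nat) (x : 'I_k -> L) (P : 'M[K]_(n, k)).
Hypothesis hP : abelian_mod g V h.
Hypothesis hx : forall i, h (x i).
Local Notation B := (\matrix_i phi (x i)).
Local Notation W := (V + \matrix_i phi (x i))%MS.
Hypothesis hW : forall u, h u -> (phi u <= W)%MS.
Hypothesis BP : B *m P = 1%:M.
Hypothesis VP : V *m P = 0.
Hypothesis WP : forall w : 'rV_n, (w <= W)%MS -> (w - w *m P *m B <= V)%MS.

Let hg : h `<=` g. Proof. by case: hP => -[]. Qed.
Let hI z u : g z -> h u -> h (br z u). Proof. by case: hP => -[_ _ +] _ _; apply. Qed.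
Let hab u v : h u -> h v -> (phi (br u v) <= V)%MS.
Proof. by case: hP => _ _; apply. Qed.
Let gbr u v : g u -> g v -> g (br u v). Proof. by case: gP => _ _ _; apply. Qed.

Lemma coord0 (w : 'rV_n) : (w <= V)%MS -> w *m P = 0.
Proof. by case/submxP => c ->; rewrite -mulmxA VP mulmx0. Qed.

Lemma sub_of_coord0 (w : 'rV_n) : (w <= W)%MS -> w *m P = 0 -> (w <= V)%MS.
Proof. by move=> /WP + w0; rewrite w0 mul0mx subr0. Qed.

Lemma VW : (V <= W)%MS. Proof. exact: addsmxSl. Qed.

(** The matrix of the bracket with [z] on [W] modulo [V], in the basis [x].
    That bracket is only semilinear over [K], which is what the derivative in
    [vf_br_coord] accounts for. *)
Definition ad_mx z : 'M[K]_k := \matrix_i (phi (br z (x i)) *m P).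

Lemma row_ad_mx z i : row i (ad_mx z) = phi (br z (x i)) *m P.
Proof. by rewrite rowK. Qed.

Lemma ad_mxE z : ad_mx z = (\matrix_i phi (br z (x i))) *m P.
Proof. by apply/row_matrixP => i; rewrite row_mul !rowK. Qed.

Lemma vf_br_coord z (w : 'rV_n) : g z -> (w <= W)%MS ->
  vf_br (phi z) w *m P = map_mx (vf_act (phi z)) (w *m P) + w *m P *m ad_mx z.
Proof.
move=> gz wW; rewrite -{1}[w](subrK (w *m P *m B)) vf_brDr mulmxDl.
rewrite (coord0 (stV gz (WP wW))) add0r vf_br_comb mulmxDl.
by rewrite -!mulmxA BP mulmx1 ad_mxE.
Qed.

Lemma W_stable : vf_stable g W.
Proof.
move=> z w gz /sub_addsmxP[[a c] /= ->].
rewrite vf_brDr addmx_sub //.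
  by rewrite (submx_trans _ VW) // stV // submxMl.
rewrite vf_br_comb addmx_sub //.
  by rewrite (submx_trans _ (addsmxSr _ _)) // submxMl.
rewrite (submx_trans (submxMl _ _)) //.
by apply/row_subP => i; rewrite rowK; apply: hW; exact: hI.
Qed.

Lemma W_spanned : vf_spanned g W.
Proof.
move=> c c0 w /sub_addsmxP[[a b] /= ->].
rewrite vf_actDl [X in _ + X]vf_act_comb [X in _ + X]big1 ?addr0 => [|i _].
  apply: (spV _ (submxMl _ _)) => u gu uV. 
  by apply: c0 => //; rewrite (submx_trans uV VW).
by rewrite rowK c0 ?mulr0 //; [exact: hg|exact: hW].
Qed.

(** For [u] in [g :&: V] the bracket of [u] with [y] lies in [V], and so do
    its brackets with the [x i]: hence [u] kills the coordinates of [y].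
    [vf_spanned] extends this to all of [V]. *)
Lemma coord_constV y (v : 'rV_n) : g y -> (phi y <= W)%MS -> (v <= V)%MS ->
  map_mx (vf_act v) (phi y *m P) = 0.
Proof.
move=> gy yW vV; apply/rowP => j; rewrite [LHS]mxE [RHS]mxE.
apply: (spV _ vV) => u gu uV.
have VbrC z : g z -> (phi (br u z) <= V)%MS.
  by move=> gz; rewrite (lieC brP) phiN eqmx_opp phi_br stV.
have := vf_br_coord gu yW; rewrite -phi_br coord0 ?VbrC //.
rewrite (_ : ad_mx u = 0) ?mulmx0 ?addr0; last first.
  by apply/row_matrixP => i; rewrite row_ad_mx coord0 ?row0 // VbrC //; exact: hg.
by move/rowP => /(_ j); rewrite [LHS]mxE [RHS]mxE.
Qed.

Lemma coord_constW (c : 'rV_k) :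
  (forall i, map_mx (vf_act (phi (x i))) c = 0) ->
  (forall v : 'rV_n, (v <= V)%MS -> map_mx (vf_act v) c = 0) ->
  forall w : 'rV_n, (w <= W)%MS -> map_mx (vf_act w) c = 0.
Proof.
move=> cx cV w wW; apply/rowP => j; rewrite [LHS]mxE [RHS]mxE.
rewrite -[w](subrK (w *m P *m B)) vf_actDl vf_act_comb big1 ?addr0 => [|i _].
  by have := cV _ (WP wW) => /rowP/(_ j); rewrite [LHS]mxE [RHS]mxE.
by have := cx i => /rowP/(_ j); rewrite [LHS]mxE [RHS]mxE rowK => ->; rewrite mulr0.
Qed.

Lemma ad_mx_h u : h u -> ad_mx u = 0.
Proof. by move=> hu; apply/row_matrixP => i; rewrite row_ad_mx coord0 ?row0 ?hab. Qed.

(** The coordinates of a field of [h] are constant along [W]: along the [x i]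
    because [h] is abelian modulo [V], and along [V] by [coord_constV].  So the
    derivative in [vf_br_coord] vanishes and [y] acts linearly. *)
Lemma coord_ad y w : g y -> (phi y <= W)%MS -> h w ->
  phi (br y w) *m P = phi w *m P *m ad_mx y.
Proof.
move=> gy yW hw; rewrite phi_br vf_br_coord ?hW // coord_constW ?add0r // => [i|v vV].
  have := vf_br_coord (hg (hx i)) (hW hw).
  by rewrite -phi_br coord0 ?hab // ad_mx_h // mulmx0 addr0.
by rewrite coord_constV ?hW //; exact: hg.
Qed.

Lemma ad_mxB y y' : g y -> (phi y <= W)%MS -> g y' -> (phi y' <= W)%MS ->
  ad_mx (br y y') = ad_mx y' *m ad_mx y - ad_mx y *m ad_mx y'.
Proof.
move=> gy yW gy' yW'; apply/row_matrixP => i; rewrite row_ad_mx.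
rewrite (_ : br (br y y') (x i) = br y (br y' (x i)) - br y' (br y (x i))).
  rewrite phiD phiN mulmxBl (coord_ad gy yW (hI gy' (hx i))).
  rewrite (coord_ad gy' yW' (hI gy (hx i))).
  by rewrite linearB /= !row_mul !row_ad_mx.
by rewrite (lieJ brP y y') addrK.
Qed.

Lemma ad_mxD u v : ad_mx (u + v) = ad_mx u + ad_mx v.
Proof.
by apply/row_matrixP => i; rewrite linearD /= !row_ad_mx lieDl // phiD mulmxDl.
Qed.

Lemma ad_mxZ c u : ad_mx (c *: u) = iota c *: ad_mx u.
Proof.
by apply/row_matrixP => i; rewrite linearZ /= !row_ad_mx lieZl // phiZ -scalemxAl.
Qed.

Lemma ad_mx0 : ad_mx 0 = 0.
Proof. by apply: (addrI (ad_mx 0)); rewrite -ad_mxD !addr0. Qed.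

(** Here the coordinates of [y'], which need not be in [h], are constant along
    the [x i] because the bracket of [y'] with [x i] has zero coordinates by
    hypothesis. *)
Lemma ad_mx0_abelian y y' : g y -> (phi y <= W)%MS -> ad_mx y = 0 ->
  g y' -> (phi y' <= W)%MS -> ad_mx y' = 0 -> (phi (br y y') <= V)%MS.
Proof.
move=> gy yW y0 gy' yW' y0'; apply: sub_of_coord0; first by rewrite phi_br W_stable.
rewrite phi_br vf_br_coord // y0 mulmx0 addr0; apply: coord_constW => // [i|v vV].
  have gx := hg (hx i); have := vf_br_coord gx yW'.
  rewrite -phi_br (lieC brP) phiN mulNmx -row_ad_mx y0' row0 oppr0.
  by rewrite ad_mx_h // mulmx0 addr0.
exact: coord_constV.
Qed.

(* [h] is chosen so that [W] has least dimension; this plays the part of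
   irreducibility of the representation of [g] on [h] modulo [V]. *)
Hypothesis W_min : forall h' (W' : 'M_n), abelian_mod g V h' -> (V <= W')%MS ->
  (forall u, h' u -> (phi u <= W')%MS) -> (\rank W <= \rank W')%N.

(** The fields of [h] that [J] sends into [V] form again an ideal of [g],
    abelian modulo [V].  It is not contained in [V], because commuting
    nilpotent matrices have a common kernel, so by minimality it spans [W]
    modulo [V]. *)
Lemma ad_mx_nilpotent_ideal J : lie_ideal br g J ->
  (forall u, J u -> (phi u <= W)%MS) ->
  (forall u v, J u -> J v -> ad_mx u *m ad_mx v = ad_mx v *m ad_mx u) ->
  (forall u, J u -> exists m, ad_mx u ^+ m = 0) ->
  forall u, J u -> ad_mx u = 0.
Proof.
move=> [[J0 JD JZ JB] Jg JI] JW Jcomm Jnil.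
(* Finitely many matrices of [J] span all of them, so that the common kernel of
   a finite list is killed by the whole of [J]. *)
have [m [a [Ja _ aJ]]] :=
  exists_family_mod J (fun u => mxvec (ad_mx u)) (0 : 'M_(k * k)).
pose h' := [set w | h w /\ forall u, J u -> (phi (br u w) <= V)%MS].
have [[[h0 hD hZ hB] _ _] [w0 hw0 w0V] _] := hP.
have [w [hw wV wJ]] : exists w, [/\ h w, phi w *m P != 0 &
    forall u, J u -> phi w *m P *m ad_mx u = 0].
  pose S := [set phi w *m P | w in h].
  have [||||v [[w hw <-] w0' wa]] :=
      @common_kernel_of_commuting_nilpotents K k S [seq ad_mx (a i) | i : 'I_m].
  - by move=> _ _ /mapP[i _ ->] /mapP[j _ ->]; exact: Jcomm.
  - by move=> _ /mapP[i _ ->]; exact: Jnil.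
  - move=> _ _ /mapP[i _ ->] [w hw <-]; exists (br (a i) w).
      by apply: hI => //; exact: Jg.
    by rewrite coord_ad //; [exact: Jg|exact: JW].
  - exists (phi w0 *m P); first by exists w0.
    by apply: contraNneq w0V => /sub_of_coord0; apply; exact: hW.
  exists w; split=> // u /aJ; rewrite adds0mx => /submxP[c cE].
  rewrite -[ad_mx u]mxvecK cE [c *m _]mulmx_sum_row linear_sum mulmx_sumr big1 // => i _.
  rewrite rowK linearZ /= mxvecK -scalemxAr wa ?scaler0 //.
  by apply/mapP; exists i; rewrite ?mem_enum.
have h'P : abelian_mod g V h'.
  split; last by move=> u v [hu _] [hv _]; exact: hab.
    split=> [|u [/hg]//|z u gz [hu Ju]].
      split=> [|u v [hu Ju] [hv Jv]|c u [hu Ju]|u v [hu Ju] [hv Jv]].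
      - by split=> // u _; rewrite lie0r // phi0 sub0mx.
      - split=> [|z Jz]; first exact: hD.
        by rewrite (lieDr brP) phiD addmx_sub ?Ju ?Jv.
      - split=> [|z Jz]; first exact: hZ.
        by rewrite (lieZr brP) phiZ scalemx_sub ?Ju.
      - split=> [|z Jz]; first exact: hB.
        rewrite (lieJ brP) phiD addmx_sub ?hab //; apply: hI => //; exact: Jg.
    split=> [|u' Ju']; first exact: hI.
    rewrite (lieJ brP) phiD addmx_sub //; last by rewrite phi_br stV ?Ju.
    rewrite (lieC brP u') -scaleN1r lieZl // phiZ scalemx_sub //.
    by apply: Ju; exact: JI.
  exists w; last by apply: contra wV => /coord0->.
  split=> // u Ju; apply: sub_of_coord0; last by rewrite coord_ad ?wJ //; auto.
  by apply: hW; apply: hI => //; exact: Jg.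
have [d [y [h'y _ yh']]] := exists_family_mod h' phi V.
have WW' : (W <= V + \matrix_i phi (y i))%MS.
  have W'W : (V + \matrix_i phi (y i) <= W)%MS.
    rewrite addsmx_sub addsmxSl; apply/row_subP => i; rewrite rowK.
    by apply: hW; case: (h'y i).
  by rewrite -(mxrank_leqif_sup W'W) eqn_leq mxrankS //= (W_min h'P (addsmxSl _ _) yh').
move=> u Ju.
have yu : (\matrix_i phi (y i)) *m P *m ad_mx u = 0.
  apply/row_matrixP => i; rewrite !row_mul rowK row0.
  have [hy Jy] := h'y i.
  by rewrite -coord_ad ?coord0 ?Jy //; [exact: Jg|exact: JW].
rewrite -[LHS]mul1mx -BP.
have /sub_addsmxP[[b c] /= ->] : (B <= V + \matrix_i phi (y i))%MS.
  by rewrite (submx_trans (addsmxSr V _)).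
by rewrite mulmxDl -(mulmxA b) VP mulmx0 add0r -!mulmxA (mulmxA _ P) yu mulmx0.
Qed.

Local Notation I := [set u | g u /\ (phi u <= W)%MS].

(** tr (c (A Y - Y A)) = tr ((c A - A c) Y). *)
Lemma ad_mx_trace_bracket (c : 'M_k) y a : I y -> I a ->
  c *m ad_mx a = ad_mx a *m c -> \tr (c *m ad_mx (br y a)) = 0.
Proof.
move=> [gy yW] [ga aW] ca; rewrite ad_mxB // mulmxBr raddfB /= !mulmxA ca.
by rewrite -!mulmxA [X in X - _]mxtrace_mulC -!mulmxA subrr.
Qed.

(** Passing from brackets to the Lie algebra they generate is no loss: it is
    spanned by [S] and by further brackets inside [H]. *)
Lemma ad_mx_trace_generated (c : 'M_k) (H S : set L) : lie_subalgebra br H ->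
  H `<=` I -> S `<=` H -> (forall a, H a -> c *m ad_mx a = ad_mx a *m c) ->
  (forall s, S s -> \tr (c *m ad_mx s) = 0) ->
  forall u, lie_generated br S u -> \tr (c *m ad_mx u) = 0.
Proof.
move=> [H0 HD HZ HB] HI SH cH Str.
suff sub : lie_generated br S `<=` [set u | H u /\ \tr (c *m ad_mx u) = 0].
  by move=> u /sub[].
apply: lie_generated_min => [|s Ss]; last by split; [exact: SH|exact: Str].
split=> [|u v [Hu tu] [Hv tv]|b u [Hu tu]|u v [Hu tu] [Hv tv]].
- by split=> //; rewrite ad_mx0 mulmx0 mxtrace0.
- by split; [exact: HD|rewrite ad_mxD mulmxDr mxtraceD tu tv addr0].
- by split; [exact: HZ|rewrite ad_mxZ -scalemxAr mxtraceZ tu mulr0].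
- by split; [exact: HB|rewrite ad_mx_trace_bracket //; [exact: HI|exact: HI|exact: cH]].
Qed.

(** Otherwise let [A] be the last term of the derived series of [I] on which
    [ad_mx] does not vanish; by assumption it is not [I] itself.  Elements of the ideal
    [I, A] have nilpotent matrices by the trace criterion, since the matrices of
    [A] commute; by [ad_mx_nilpotent_ideal] they vanish, that is, the matrices
    of [A] are central.  Then the criterion applies to [A] as well, whose
    elements are sums of brackets in the previous term [M]. *)
Lemma ad_mx_commutative y y' : I y -> I y' -> ad_mx (br y y') = 0.
Proof.
move=> Iy Iy'; apply/eqP/negPn/negP => yy'0.
have II : lie_ideal br g I by apply: phi_sub_ideal => //; exact: W_stable.
have IP : lie_subalgebra br I by case: II.
pose out q := `[< exists2 u, derived_series br I q u & ad_mx u != 0 >].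
have out1 : out 1 by apply/asboolP; exists (br y y') => //; exact: derived_series_bracket.
have out_bound q : out q -> (q <= N)%N.
  move=> /asboolP[u qu]; apply: contraNleq => /ltnW Nq.
  have Ng : derived_series br I N `<=` derived_series br g N.
    by apply: derived_seriesSS => u' [].
  by rewrite (g_sol (Ng _ (derived_series_decr IP Nq qu))) ad_mx0.
have [[|p] /asboolP[a0 Aa0 a00] qmax] := ex_maxnP (ex_intro out 1 out1) out_bound.
  by have := qmax _ out1.
pose M := derived_series br I p.
pose A := derived_series br I p.+1.
have MI : M `<=` I by exact: (derived_series_decr IP (leq0n p)).
have AI : A `<=` I by exact: (derived_series_decr IP (leq0n p.+1)).
have AM : A `<=` M by exact: (derived_series_decr IP (leqnSn p)).
have MP : lie_subalgebra br M by exact: derived_series_subalgebra.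
have AP : lie_subalgebra br A by exact: derived_series_subalgebra.
have Aid : lie_ideal br g A by exact: derived_series_ideal.
have comm0 u v : I u -> I v -> ad_mx (br u v) = 0 -> ad_mx u *m ad_mx v = ad_mx v *m ad_mx u.
  by move=> [gu uW] [gv vW]; rewrite ad_mxB // => /eqP; rewrite subr_eq0 => /eqP.
have Acomm u v : A u -> A v -> ad_mx u *m ad_mx v = ad_mx v *m ad_mx u.
  move=> Au Av; apply: comm0; [exact: AI|exact: AI|].
  apply/eqP/negPn/negP => uv0.
  have /qmax : out p.+2.
    by apply/asboolP; exists (br u v) => //; exact: derived_series_bracket.
  by rewrite ltnn.
have expC (c d : 'M_k) m : c *m d = d *m c -> c ^+ m *m d = d *m c ^+ m.
  by move=> cd; apply/esym/commrX/esym.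
have nilp u : (forall m, \tr (ad_mx u ^+ m *m ad_mx u) = 0) ->
    exists m, ad_mx u ^+ m = 0.
  by move=> tr0; apply: nilpotent_of_traces => // m; rewrite exprSr; exact: tr0.
pose IA := lie_generated br [set br u v | u in I & v in A].
have IAid : lie_ideal br g IA by exact: lie_ideal_bracket.
have SA : [set br u v | u in I & v in A] `<=` A.
  by move=> _ [u [gu _] [v Av <-]]; case: Aid => _ _; apply.
have IAA : IA `<=` A by exact: lie_generated_min.
have IA0 u : IA u -> ad_mx u = 0.
  apply: (ad_mx_nilpotent_ideal IAid) => [v /IAA/AI[]//|v w /IAA Av /IAA Aw|v IAv].
    exact: Acomm.
  apply: nilp => m; have Av := IAA _ IAv.
  have cA a : A a -> ad_mx v ^+ m *m ad_mx a = ad_mx a *m ad_mx v ^+ m.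
    by move=> Aa; apply: expC; exact: Acomm.
  apply: (ad_mx_trace_generated AP AI SA cA) IAv => _ [w Iw [a Aa <-]].
  by apply: ad_mx_trace_bracket => //; [exact: AI|exact: cA].
have A0 u : A u -> ad_mx u = 0.
  apply: (ad_mx_nilpotent_ideal Aid) => [v /AI[]//|//|v Av].
  apply: nilp => m.
  have cI a : I a -> ad_mx v ^+ m *m ad_mx a = ad_mx a *m ad_mx v ^+ m.
    move=> Ia; apply: expC; apply/esym/comm0 => //; first exact: AI.
    by apply: IA0; apply: lie_generatedS; exists a => //; exists v.
  have SM : [set br u v | u in M & v in M] `<=` M.
    by move=> _ [w Mw [w' Mw' <-]]; case: MP => _ _ _; apply.
  apply: (ad_mx_trace_generated MP MI SM (fun a Ma => cI a (MI _ Ma))) Av.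
  move=> _ [w Mw [a Ma <-]].
  by apply: ad_mx_trace_bracket; [exact: MI|exact: MI|apply: cI; exact: MI].
by rewrite A0 ?eqxx in a00.
Qed.

End Step.

(** [J] is the set of fields of [W] that act trivially on [h] modulo [V]; it
    splits the passage from [W] to [V] into two abelian steps. *)
Lemma exists_step g V N : lie_subalgebra br g ->
  derived_series br g N `<=` [set 0] -> vf_stable g V -> vf_spanned g V ->
  (exists2 w, g w & ~~ (phi w <= V)%MS) ->
  exists W J, [/\ (\rank V < \rank W)%N, vf_stable g W, vf_spanned g W
    & [/\ lie_subalgebra br J,
       forall u v, g u -> (phi u <= W)%MS -> g v -> (phi v <= W)%MS -> J (br u v)
       & forall u v, J u -> J v -> (phi (br u v) <= V)%MS]].
Proof.
move=> gP g_sol stV spV gV.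
pose dim m := `[< exists h W, [/\ abelian_mod g V h, (V <= W)%MS,
  forall u, h u -> (phi u <= W)%MS & \rank W = m] >].
have ex_dim : exists m, dim m.
  have [h hP] := exists_abelian_mod gP g_sol gV.
  exists (\rank (1%:M : 'M[K]_n)); apply/asboolP.
  by exists h, 1%:M; split=> // [|u _]; rewrite submx1.
have [m /asboolP[h [W0 [hP VW0 hW0 <-]]] mmin] := ex_minnP ex_dim.
have [k [x [hx rkW hW]]] := exists_family_mod h phi V.
have [P [BP VP WP]] := exists_coordinates_mod rkW.
have Wmin h' W' : abelian_mod g V h' -> (V <= W')%MS ->
    (forall u, h' u -> (phi u <= W')%MS) ->
    (\rank (V + \matrix_i phi (x i))%MS <= \rank W')%N.
  move=> h'P VW' h'W'; apply: leq_trans (mmin (\rank W') _).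
    rewrite mxrankS // addsmx_sub VW0; apply/row_subP => i.
    by rewrite rowK; exact: hW0.
  by apply/asboolP; exists h', W'.
pose W := (V + \matrix_i phi (x i))%MS.
have stW : vf_stable g W by exact: (W_stable stV hP hx hW).
have spW : vf_spanned g W by exact: (W_spanned spV hP hx hW).
exists W, [set u | [/\ g u, (phi u <= W)%MS & ad_mx x P u = 0]].
split=> //.
  rewrite rkW -addn1 leq_add2l lt0n; apply/eqP => k0.
  case: hP => _ [w hw /negP wV] _; apply: wV.
  rewrite (submx_trans (hW w hw)) // addsmx_sub submx_refl.
  by apply/row_subP => i; have := ltn_ord i; rewrite {2}k0.
have WB u v : g u -> (phi u <= W)%MS -> g v -> (phi v <= W)%MS ->
    [/\ g (br u v), (phi (br u v) <= W)%MS & ad_mx x P (br u v) = 0].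
  move=> gu uW gv vW; split; last first.
  - exact: (ad_mx_commutative gP g_sol stV spV hP hx hW BP VP WP Wmin).
  - by rewrite phi_br stW.
  - by case: gP => _ _ _; apply.
split=> [|u v|u v [gu uW u0] [gv vW v0]]; last 2 first.
- exact: WB.
- exact: (ad_mx0_abelian stV spV hP hx hW BP VP WP).
have [g0 gD gZ gB] := gP.
split=> [|u v [gu uW u0] [gv vW v0]|c u [gu uW u0]|u v [gu uW u0] [gv vW v0]].
- by rewrite /= phi0 sub0mx ad_mx0; split.
- by split; [exact: gD|rewrite phiD addmx_sub|rewrite ad_mxD u0 v0 addr0].
- by split; [exact: gZ|rewrite phiZ scalemx_sub|rewrite ad_mxZ u0 scaler0].
- exact: WB.
Qed.

(** Induction on the codimension of [V]: each step of the chain raises the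
    dimension and costs two terms of the derived series. *)
Lemma derived_series_rank_bound g V N : lie_subalgebra br g ->
  derived_series br g N `<=` [set 0] -> vf_stable g V -> vf_spanned g V ->
  forall u, derived_series br g (2 * (n - \rank V)) u -> (phi u <= V)%MS.
Proof.
move=> gP g_sol; have [m] := ubnP (n - \rank V).
elim: m => // m IHm in V * => ltm stV spV.
have [all_in|] := pselect (forall u, g u -> (phi u <= V)%MS).
  by move=> u /(derived_series_decr gP (leq0n _)); exact: all_in.
case/existsNP => w /not_implyP[gw /negP wV].
have [W [J [rkVW stW spW [JP WJ JV]]]] :=
  exists_step gP g_sol stV spV (ex_intro2 _ _ w gw wV).
have rkW := rank_leq_col W.
set d := (2 * (n - \rank W))%N.
have dW u : derived_series br g d u -> g u /\ (phi u <= W)%MS.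
  move=> du; split; first exact: (derived_series_decr gP (leq0n d)).
  by apply: IHm => //; lia.
have d1 : derived_series br g d.+1 `<=` J.
  by apply: derived_seriesS_min => // u v /dW[gu uW] /dW[gv vW]; exact: WJ.
have d2 : derived_series br g d.+2 `<=` [set u | g u /\ (phi u <= V)%MS].
  apply: derived_seriesS_min => [|u v du dv]; first exact: phi_sub_subalgebra.
  split; last by apply: JV; exact: d1.
  case: (gP) => _ _ _; apply; exact: (derived_series_decr gP (leq0n d.+1)).
move=> u du; suff /d2[] : derived_series br g d.+2 u by [].
by apply: (derived_series_decr gP _ du); rewrite /d; lia.
Qed.

Theorem derived_series_solvable_bound g N : lie_subalgebra br g ->
  derived_series br g N `<=` [set 0] -> derived_series br g (2 * n) `<=` [set 0].
Proof.
move=> gP g_sol u.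
have stV : vf_stable g 0.
  move=> z w gz; rewrite !submx0 => /eqP->; apply/eqP.
  by apply: (addrI (vf_br (phi z) 0)); rewrite -vf_brDr !addr0.
have spV : vf_spanned g 0.
  move=> y _ v; rewrite submx0 => /eqP->.
  by rewrite /vf_act big1 // => i _; rewrite mxE mul0r.
have := derived_series_rank_bound gP g_sol stV spV (u := u).
by rewrite mxrank0 subn0 submx0 => du /du/eqP/phi_inj.
Qed.

End VectorFields.

(** * The integral domain of formal power series *)

(** An enumeration of the finite index set of the sum that defines [fps_mul],
    which gives access to the theory of sums over sequences. *)
Definition splits n (m : mono n) : seq (mono n * mono n) :=
  fset_set [set p : mono n * mono n | p.1 + p.2 = m].

Lemma mem_splits n (m : mono n) p : (p \in splits m) = (p.1 + p.2 == m).
Proof.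
by rewrite in_fset_set ?inE; [apply/asboolP/eqP|exact: finite_mono_splits].
Qed.

Lemma splits_uniq n (m : mono n) : uniq (splits m).
Proof. exact: finmap.fset_uniq. Qed.

Lemma splits_swap n (m : mono n) :
  perm_eq (splits m) [seq (p.2, p.1) | p <- splits m].
Proof.
apply: uniq_perm => [||[a b]]; rewrite ?map_inj_uniq ?splits_uniq //.
  by move=> [a b] [a' b'] /= [-> ->].
apply/idP/mapP => [|[[a' b'] + [-> ->]]]; rewrite !mem_splits /= addrC // => ab.
by exists (b, a); rewrite ?mem_splits.
Qed.

Lemma mono_addIr n (e : mono n) : injective (fun a : mono n => a + e).
Proof.
move=> a b /ffunP ab; apply/ffunP => i; have := ab i.
by rewrite !ffunE; exact: addIn.
Qed.

Lemma splits_shift n (m : mono n) (i : 'I_n) :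
  perm_eq [seq p : mono n * mono n <- splits (m + mono_var i) | p.1 i != 0%N]
          [seq (p.1 + mono_var i, p.2) | p <- splits m].
Proof.
apply: uniq_perm => [||[a b]].
- by rewrite filter_uniq ?splits_uniq.
- rewrite map_inj_uniq ?splits_uniq // //.
  by move=> [a b] [a' b'] [/mono_addIr-> ->].
- rewrite mem_filter mem_splits; apply/andP/mapP => /= [[ai /eqP ab]|[[a' b']]].
    pose a' : mono n := [ffun j => a j - (j == i)]%N.
    have aE : a = a' + mono_var i.
      apply/ffunP => j; rewrite !ffunE.
      case: eqP => [->|_]; rewrite -[RHS]/(_ + _)%N /=; last by rewrite subn0 addn0.
      by rewrite subnK // lt0n.
    exists (a', b); rewrite ?aE // mem_splits /=; apply/eqP.
    by apply: (mono_addIr (e := mono_var i)); rewrite /= -ab aE addrAC.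
  rewrite mem_splits /= => /eqP<- [-> ->]; rewrite !ffunE eqxx addrAC.
  by rewrite addrC.
Qed.

(** A copy of [fps K n] that carries the Cauchy product: [fps K n] itself is a
    type of functions, and unfolds to a ring for the pointwise product. *)
Definition powser (K : comNzRingType) n : Type := fps K n.

Section PowserRing.
Variables (K : comNzRingType) (n : nat).
Implicit Types (f g h : fps K n) (m : mono n).

Lemma fps_mulE f g m : fps_mul f g m = \sum_(p <- splits m) f p.1 * g p.2.
Proof. by rewrite /fps_mul fsbig_finite //; exact: finite_mono_splits. Qed.

Lemma fps_mulA : associative (@fps_mul K n).
Proof.
move=> f g h; apply/funext => m; rewrite !fps_mulE.
pose F (t : mono n * mono n * mono n) := f t.1.1 * g t.1.2 * h t.2.
transitivity (\sum_(t <- [seq (p.1, q.1, q.2) | p <- splits m, q <- splits p.2]) F t).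
  rewrite big_allpairs_dep; apply: eq_bigr => p _.
  by rewrite fps_mulE mulr_sumr; apply: eq_bigr => q _; rewrite mulrA.
transitivity (\sum_(t <- [seq (q.1, q.2, p.2) | p <- splits m, q <- splits p.1]) F t).
  apply: perm_big; apply: uniq_perm => [||[[a b] c]].
  - apply: allpairs_uniq_dep => [|p _|]; try exact: splits_uniq.
    move=> _ _ /allpairsPdep[p [q [_ + ->]]] /allpairsPdep[p' [q' [_ + ->]]] /=.
    rewrite !mem_splits; case: p p' q q' => [p1 p2] [p1' p2'] [q1 q2] [q1' q2'] /=.
    by move=> /eqP<- /eqP<- [-> -> ->].
  - apply: allpairs_uniq_dep => [|p _|]; try exact: splits_uniq.
    move=> _ _ /allpairsPdep[p [q [_ + ->]]] /allpairsPdep[p' [q' [_ + ->]]] /=.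
    rewrite !mem_splits; case: p p' q q' => [p1 p2] [p1' p2'] [q1 q2] [q1' q2'] /=.
    by move=> /eqP<- /eqP<- [-> -> ->].
  - apply/allpairsPdep/allpairsPdep => -[p [q []]];
      rewrite !mem_splits => /eqP pm /eqP qp [-> -> ->].
      exists (p.1 + q.1, q.2), (p.1, q.1).
      by rewrite !mem_splits /= -addrA qp pm !eqxx.
    exists (q.1, q.2 + p.2), (q.2, p.2).
    by rewrite !mem_splits /= addrA qp pm !eqxx.
rewrite big_allpairs_dep; apply: eq_bigr => p _.
by rewrite fps_mulE mulr_suml.
Qed.

Lemma fps_mulC : commutative (@fps_mul K n).
Proof.
move=> f g; apply/funext => m; rewrite !fps_mulE.
rewrite (perm_big _ (splits_swap m)) big_map.
by apply: eq_bigr => p _; rewrite mulrC.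
Qed.

Definition fps1 : fps K n := fun m => (m == 0)%:R.

Lemma fps_mul1 : left_id fps1 (@fps_mul K n).
Proof.
move=> f; apply/funext => m; rewrite fps_mulE (bigD1_seq (0, m)) ?splits_uniq //=; last first.
  by rewrite mem_splits add0r.
rewrite /fps1 eqxx mul1r big_seq_cond big1 ?addr0 // => -[a b] /andP[].
rewrite mem_splits xpair_eqE /= => /eqP<-.
by have [->|_] := eqVneq a 0; rewrite ?add0r ?eqxx // mul0r.
Qed.

Lemma fps_mulDl : left_distributive (@fps_mul K n) +%R.
Proof.
move=> f g h; apply/funext => m.
rewrite -[RHS]/(fps_mul f h m + fps_mul g h m) !fps_mulE -big_split.
by apply: eq_bigr => p _; rewrite /= -mulrDl.
Qed.

Lemma fps1_neq0 : fps1 != 0.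
Proof.
apply/eqP => /(congr1 (fun f : fps K n => f 0)); rewrite /fps1 eqxx.
by move/eqP; rewrite oner_eq0.
Qed.

HB.instance Definition _ := GRing.Zmodule.copy (powser K n) (fps K n).
HB.instance Definition _ := GRing.Zmodule_isComNzRing.Build (powser K n)
  fps_mulA fps_mulC fps_mul1 fps_mulDl fps1_neq0.

End PowserRing.

Definition powser_unit (K : comNzRingType) n : {pred powser K n} :=
  fun f => `[< exists g, g * f = 1 >].

Definition powser_inv (K : comNzRingType) n (f : powser K n) : powser K n :=
  if pselect (exists g, g * f = 1) is left e then sval (cid e) else f.

Section PowserDomain.
Variables (K : idomainType) (n : nat).

Lemma powser_mulVx : {in @powser_unit K n, left_inverse 1 (@powser_inv K n) *%R}.
Proof.
move=> f /asboolP fu; rewrite /powser_inv; case: pselect => // e.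
by case: cid.
Qed.

Lemma powser_unitPl (f g : powser K n) : g * f = 1 -> powser_unit f.
Proof. by move=> gf; apply/asboolP; exists g. Qed.

Lemma powser_invr_out : {in [predC @powser_unit K n], @powser_inv K n =1 id}.
Proof.
move=> f; rewrite inE => /asboolPn fu.
by rewrite /powser_inv; case: pselect.
Qed.

HB.instance Definition _ := GRing.ComNzRing_hasMulInverse.Build (powser K n)
  powser_mulVx powser_unitPl powser_invr_out.

(** The least exponent of the support for the lexicographic order, one variable
    at a time; [k] is the number of variables already treated. *)
Definition lex_min (f : fps K n) (k : nat) (m : mono n) : Prop :=
  f m != 0 /\ forall p, f p != 0 -> forall i : 'I_n, (i < k)%N ->
    (forall j : 'I_n, (j < i)%N -> p j = m j) -> (m i <= p i)%N.

Lemma exists_lex_min (f : fps K n) : f != 0 -> exists m, lex_min f n m.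
Proof.
move=> f0; suff : forall k, (k <= n)%N -> exists m, lex_min f k m by apply.
elim=> [|k IHk] kn.
  have [m fm] : exists m, f m != 0.
    apply: contrapT => /forallNP fE; case/eqP: f0; apply/funext => m.
    by apply/eqP/negPn/negP => /fE.
  by exists m; split.
have [m [fm mmin]] := IHk (ltnW kn).
pose ik := Ordinal kn.
have ex_v : exists v, `[< exists p, [/\ f p != 0, p ik = v
    & forall j : 'I_n, (j < k)%N -> p j = m j] >].
  by exists (m ik); apply/asboolP; exists m.
have [v /asboolP[p [fp pv pm]] vmin] := ex_minnP ex_v.
exists p; split=> // q fq i; rewrite ltnS leq_eqVlt => /predU1P[ik_eq|ltik] qp.
  have -> : i = ik by exact/val_inj.
  rewrite pv; apply: vmin; apply/asboolP; exists q; split=> // j jk.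
  by rewrite qp ?pm // ik_eq.
by rewrite pm //; apply: mmin => // j ji; rewrite qp ?pm // (ltn_trans ji).
Qed.

(** The coefficient of a product at the sum of the two lexicographically least
    exponents consists of a single term. *)
Lemma powser_integral (f g : powser K n) : f * g = 0 -> (f == 0) || (g == 0).
Proof.
apply: contra_eqT; rewrite negb_or.
case/andP=> /exists_lex_min[a [fa amin]] /exists_lex_min[b [gb bmin]].
apply/negP => /eqP/(congr1 (fun f : fps K n => f (a + b))).
rewrite -[LHS]/(fps_mul f g (a + b)) -[RHS]/(0 : K) fps_mulE.
rewrite (bigD1_seq (a, b)) ?splits_uniq ?mem_splits //= big_seq_cond big1 ?addr0.
  by move/eqP; rewrite mulf_eq0 (negPf fa) (negPf gb).
move=> [p q] /andP[]; rewrite mem_splits /= => /eqP pq pq_neq.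
apply/eqP; rewrite mulf_eq0; apply/negPn/negP; rewrite negb_or => /andP[fp gq].
suff pa k (i : 'I_n) : (i < k)%N -> p i = a i /\ q i = b i.
  case/eqP: pq_neq; congr (_, _); apply/ffunP => i; by case: (pa i.+1 i (leqnn _)).
elim: k i => // k IHk i; rewrite ltnS => ik.
have pqi : (p i + q i = a i + b i)%N by move/ffunP/(_ i): pq; rewrite !ffunE.
have := amin p fp i (ltn_ord i) (fun j ji => (IHk j (leq_trans ji ik)).1).
have := bmin q gq i (ltn_ord i) (fun j ji => (IHk j (leq_trans ji ik)).2).
by lia.
Qed.

HB.instance Definition _ :=
  GRing.ComUnitRing_isIntegral.Build (powser K n) powser_integral.

End PowserDomain.

(** * Partial derivatives and their extension to fractions *)

Section PowserDerivations.
Variables (K : idomainType) (n : nat).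
Implicit Types (f g : powser K n) (m : mono n).

Definition powser_d (i : 'I_n) (f : powser K n) : powser K n := fps_partial i f.

Definition powser_var (i : 'I_n) : powser K n := fun m => (m == mono_var i)%:R.

Definition powser_const (c : K) : powser K n := c *: @fps1 K n.

Lemma powser_dD i : {morph powser_d i : f g / f + g}.
Proof. by move=> f g; apply/funext => m; exact: mulrnDl. Qed.

(** One half of the Leibniz rule: terms of weight [p.1 i = 0] vanish, and the
    others are reindexed by lowering the exponent of the variable [i]. *)
Lemma sum_splits_weight (f g : fps K n) (i : 'I_n) m :
  \sum_(p <- splits (m + mono_var i)) f p.1 *+ (p.1 : mono n) i * g p.2
    = fps_mul (fps_partial i f) g m.
Proof.
rewrite (bigID (fun p : mono n * mono n => p.1 i == 0%N)) /= big1 ?add0r => [|p /eqP->]; last first.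
  by rewrite mulr0n mul0r.
rewrite -big_filter (perm_big _ (splits_shift m i)) big_map fps_mulE.
apply: eq_bigr => p _ /=; rewrite /fps_partial !ffunE eqxx; congr (_ *+ _ * _).
exact: addn1.
Qed.

Lemma powser_dM i f g : powser_d i (f * g) = powser_d i f * g + f * powser_d i g.
Proof.
apply/funext => m; rewrite -[RHS]/(fps_mul _ _ m + fps_mul _ _ m).
rewrite /powser_d {1}/fps_partial -[(f * g) _]/(fps_mul f g _) !fps_mulE.
have weights (p : mono n * mono n) : p \in splits (m + mono_var i) ->
    (p.1 i + p.2 i = (m i).+1)%N.
  by rewrite mem_splits => /eqP/ffunP/(_ i); rewrite !ffunE eqxx => E; exact: etrans E (addn1 _).
rewrite -sumrMnl big_seq_cond.
rewrite (eq_bigr (fun p : mono n * mono n =>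
    f p.1 *+ p.1 i * g p.2 + f p.1 * (g p.2 *+ p.2 i))); last first.
  move=> p /andP[/weights pE _].
  by rewrite -pE mulrnDr mulrnAl mulrnAr.
rewrite -big_seq_cond big_split /=.
rewrite sum_splits_weight fps_mulE; congr (_ + _).
rewrite -[RHS](fps_mulE f (fps_partial i g)) fps_mulC -[RHS](sum_splits_weight g f i m).
rewrite (perm_big _ (splits_swap _)) big_map.
by apply: eq_bigr => p _; rewrite mulrC.
Qed.

Lemma powser_dC i j f : powser_d i (powser_d j f) = powser_d j (powser_d i f).
Proof.
apply/funext => m; rewrite /powser_d /fps_partial -!mulrnA addrAC; congr (_ *+ _).
rewrite !ffunE; have [->//|_] := eqVneq i j.
by rewrite !addr0 mulnC.
Qed.

Lemma powser_d_var i j : powser_d i (powser_var j) = (i == j)%:R.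
Proof.
apply/funext => m; rewrite /powser_d /fps_partial /powser_var.
have -> : (((i == j)%:R : powser K n) : fps K n) m = ((m == 0) && (i == j))%:R.
  by case: (i == j); rewrite ?andbT ?andbF.
have -> : (m + mono_var i == mono_var j) = (m == 0) && (i == j).
  apply/eqP/andP => [/ffunP E|[/eqP-> /eqP->]]; last by rewrite add0r.
  have {}E l : (m l + (l == i) = (l == j))%N by have := E l; rewrite !ffunE.
  have ij : i = j by apply/eqP; have := E i; rewrite eqxx; case: (i == j); lia.
  split; apply/eqP => //; apply/ffunP => l; have := E l; rewrite ij ffunE.
  by rewrite -[X in _ = X]add0n => /addIn.
by have [->|] := eqVneq m 0; rewrite ?ffunE // mul0rn.
Qed.

Lemma powser_d_const i c : powser_d i (powser_const c) = 0.
Proof.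
apply/funext => m; rewrite /powser_d /fps_partial.
rewrite -[powser_const c _]/(c * (m + mono_var i == 0)%:R : K).
rewrite (_ : _ == 0 = false) ?mulr0 ?mul0rn //.
by apply/eqP => /ffunP/(_ i); rewrite !ffunE eqxx; lia.
Qed.

Lemma powser_scaleE c (f : fps K n) : c *: f = (powser_const c * f : powser K n).
Proof.
apply/funext => m.
rewrite -[LHS]/(c * f m) -{1}[f](mul1r (f : powser K n)) -[RHS]/(fps_mul _ _ m).
rewrite -[X in c * X]/(fps_mul (1 : powser K n) f m) !fps_mulE mulr_sumr.
by apply: eq_bigr => p _; rewrite mulrA.
Qed.

Lemma powser_char0 : (forall k, k.+1%:R != 0 :> K) ->
  forall k, k.+1%:R != 0 :> powser K n.
Proof.
move=> char0 k; apply/eqP => /(congr1 (fun f : fps K n => f 0)).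
have -> : forall j, (j%:R : powser K n) 0 = j%:R :> K.
  elim=> // j IHj; rewrite -[j.+1%:R in RHS]natr1 -IHj -natr1.
  by rewrite -[LHS]/((j%:R : powser K n) 0 + (0 == 0 :> mono n)%:R) eqxx.
by apply/eqP; rewrite char0.
Qed.

End PowserDerivations.

(** The next three identities express that the quotient rule is additive,
    satisfies the Leibniz rule, and does not depend on the representative of
    the fraction.  They are separated from the fraction field because [field]
    would otherwise unfold its construction. *)
Lemma quotient_ruleD (F : fieldType) (a b a' b' da db da' db' : F) :
  b != 0 -> b' != 0 ->
  ((da * b' + a * db' + (da' * b + a' * db)) * (b * b')
    - (a * b' + a' * b) * (db * b' + b * db')) / (b * b') ^+ 2
  = (da * b - a * db) / b ^+ 2 + (da' * b' - a' * db') / b' ^+ 2.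
Proof. by move=> b0 b'0; field; rewrite b0 b'0. Qed.

Lemma quotient_ruleM (F : fieldType) (a b a' b' da db da' db' : F) :
  b != 0 -> b' != 0 ->
  ((da * a' + a * da') * (b * b') - a * a' * (db * b' + b * db')) / (b * b') ^+ 2
  = (da * b - a * db) / b ^+ 2 * (a' / b') + a / b * ((da' * b' - a' * db') / b' ^+ 2).
Proof. by move=> b0 b'0; field; rewrite b0 b'0. Qed.

Lemma quotient_rule_cross (R : comNzRingType) (a b N M da db dN dM : R) :
  a * M = N * b -> da * M + a * dM = dN * b + N * db ->
  (dN * M - N * dM) * b ^+ 2 = (da * b - a * db) * M ^+ 2.
Proof.
move=> aM daM; apply/eqP; rewrite -subr_eq0.
rewrite (_ : _ - _ = b * M * (dN * b + N * db - (da * M + a * dM))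
  + (a * M - N * b) * (b * dM + M * db)); last by ring.
by rewrite daM aM !subrr mulr0 mul0r addr0.
Qed.

Section FractionDerivation.
Variables (R : idomainType) (d : R -> R).
Hypothesis dD : {morph d : x y / x + y}.
Hypothesis dM : forall x y, d (x * y) = d x * y + x * d y.
Local Notation "x %:F" := (@FracField.tofrac R x).

Definition frac_d (x : {fraction R}) : {fraction R} :=
  let r := repr x in
  ((d \n_r)%:F * (\d_r)%:F - (\n_r)%:F * (d \d_r)%:F) / (\d_r)%:F ^+ 2.

Lemma frac_reprE (x : {fraction R}) : x = (\n_(repr x))%:F / (\d_(repr x))%:F.
Proof.
have d0 : \d_(repr x) != 0 by exact: denom_ratioP.
apply: (canRL (mulfK _)); first by rewrite tofrac_eq0.
rewrite -{1}[x]reprK; unlock FracField.tofrac.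
rewrite -[LHS]FracField.pi_mul; apply/eqmodP => /=.
rewrite FracField.equivfE /FracField.mulf !numden_Ratio ?mulf_neq0 ?oner_neq0 //.
by rewrite !mulr1 mulrC.
Qed.

Lemma fracP (x : {fraction R}) : exists a b : R, b != 0 /\ x = a%:F / b%:F.
Proof.
exists \n_(repr x), \d_(repr x); split; last exact: frac_reprE.
exact: denom_ratioP.
Qed.

Lemma frac_dE (a b : R) : b != 0 ->
  frac_d (a%:F / b%:F) = ((d a)%:F * b%:F - a%:F * (d b)%:F) / b%:F ^+ 2.
Proof.
move=> b0; rewrite /frac_d; set r := repr _.
have r0 : \d_r != 0 by exact: denom_ratioP.
have aM : a * \d_r = \n_r * b.
  apply/eqP; rewrite -tofrac_eq !tofracM -eqr_div ?tofrac_eq0 //.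
  by apply/eqP; exact: frac_reprE.
move: {r} \n_r \d_r r0 aM => N M M0 aM.
have daM : d a * M + a * d M = d N * b + N * d b by rewrite -!dM aM.
apply/eqP; rewrite eqr_div ?expf_neq0 ?tofrac_eq0 //; apply/eqP.
by apply: quotient_rule_cross; rewrite -!tofracM -?tofracD ?daM ?aM.
Qed.

Lemma derivation1 : d 1 = 0.
Proof. by apply: (addrI (d 1)); rewrite addr0 -{3}[1](mulr1 1) dM mulr1 mul1r. Qed.

Lemma frac_d_tofrac a : frac_d a%:F = (d a)%:F.
Proof.
rewrite -[a%:F]divr1 -(tofrac1 R) frac_dE ?oner_neq0 // derivation1.
by rewrite tofrac0 mulr0 subr0 tofrac1 expr1n !divr1 mulr1.
Qed.

Lemma frac_dD : {morph frac_d : x y / x + y}.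
Proof.
move=> x y; have [a [b [b0 ->]]] := fracP x; have [a' [b' [b'0 ->]]] := fracP y.
rewrite addf_div ?tofrac_eq0 // -!tofracM -tofracD !frac_dE ?mulf_neq0 //.
rewrite dD !dM !tofracD !tofracM.
by apply: quotient_ruleD; rewrite tofrac_eq0.
Qed.

Lemma frac_dM x y : frac_d (x * y) = frac_d x * y + x * frac_d y.
Proof.
have [a [b [b0 ->]]] := fracP x; have [a' [b' [b'0 ->]]] := fracP y.
rewrite mulf_div -!tofracM !frac_dE ?mulf_neq0 //.
rewrite !dM !tofracD !tofracM.
by apply: quotient_ruleM; rewrite tofrac_eq0.
Qed.

End FractionDerivation.

(** * Formal vector fields as a Lie algebra *)

Section VfLie.
Variables (K : idomainType) (n : nat).
Local Notation vf := {ffun 'I_n -> fps K n}.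
Implicit Types (X Y Z : vf) (f g : powser K n).

Definition act X (f : powser K n) : powser K n := vf_apply X f.

Lemma actE X f : act X f = \sum_i (X i : powser K n) * powser_d i f.
Proof. by []. Qed.

Lemma powser_d0 i : powser_d i (0 : powser K n) = 0.
Proof. by apply: (addrI (powser_d i 0)); rewrite -powser_dD !addr0. Qed.

Lemma powser_d_sum i (I : Type) (r : seq I) (F : I -> powser K n) :
  powser_d i (\sum_(j <- r) F j) = \sum_(j <- r) powser_d i (F j).
Proof. by apply: (big_morph (powser_d i)) => [f g|]; rewrite ?powser_dD ?powser_d0. Qed.

Lemma actD X f g : act X (f + g) = act X f + act X g.
Proof. by rewrite !actE -big_split; apply: eq_bigr => i _; rewrite powser_dD mulrDr. Qed.

Lemma act0 X : act X 0 = 0.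
Proof. by apply: (addrI (act X 0)); rewrite -actD !addr0. Qed.

Lemma actN X f : act X (- f) = - act X f.
Proof. by apply: (addrI (act X f)); rewrite -actD !subrr act0. Qed.

Lemma actB X f g : act X (f - g) = act X f - act X g.
Proof. by rewrite actD actN. Qed.

Lemma actM X f g : act X (f * g) = act X f * g + f * act X g.
Proof.
rewrite !actE mulr_suml mulr_sumr -big_split; apply: eq_bigr => i _.
by rewrite powser_dM /=; ring.
Qed.

Lemma act_const X c : act X (@powser_const K n c) = 0.
Proof. by rewrite actE big1 // => i _; rewrite powser_d_const mulr0. Qed.

Lemma vf_bracketE X Y j : vf_bracket X Y j = act X (Y j) - act Y (X j).
Proof. by rewrite ffunE. Qed.

(** The terms with second derivatives cancel because partial derivatives
    commute. *)
Lemma act_bracket X Y f : act (vf_bracket X Y) f = act X (act Y f) - act Y (act X f).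
Proof.
have act2 Z W : act Z (act W f) = (\sum_i act Z (W i) * powser_d i f)
    + \sum_i \sum_j (Z j : powser K n) * W i * powser_d j (powser_d i f).
  rewrite actE [act W f]actE.
  under eq_bigr => i _.
    rewrite powser_d_sum mulr_sumr.
    under eq_bigr => j _ do rewrite powser_dM mulrDr !mulrA.
    rewrite big_split; over.
  rewrite big_split /=; congr (_ + _); last by rewrite exchange_big.
  rewrite exchange_big; apply: eq_bigr => j _.
  by rewrite actE mulr_suml.
rewrite !act2 opprD addrACA -sumrB.
rewrite [X in _ + (X - _)]exchange_big /= -sumrB [X in _ + X]big1 ?addr0 => [|i _]; last first.
  rewrite -sumrB big1 // => j _.
  by rewrite (powser_dC i j) (mulrC (Y j : powser K n)) subrr.
by rewrite actE; apply: eq_bigr => j _; rewrite vf_bracketE mulrBl.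
Qed.

Lemma vf_lie_axioms : lie_axioms (@vf_bracket K n).
Proof.
split=> [X Y Z|c X Y|X Y|X Y Z]; apply/ffunP => j.
- rewrite [RHS]ffunE !vf_bracketE !ffunE.
  rewrite [act X _]actD.
  have -> : act (Y + Z) (X j) = act Y (X j) + act Z (X j).
    rewrite !actE -big_split; apply: eq_bigr => i _.
    by rewrite ffunE; exact: (@mulrDl (powser K n)).
  by rewrite opprD addrACA.
- rewrite [RHS]ffunE !vf_bracketE ffunE.
  rewrite !powser_scaleE actM act_const mul0r add0r mulrBr; congr (_ - _).
  rewrite !actE mulr_sumr; apply: eq_bigr => i _.
  by rewrite ffunE powser_scaleE mulrA.
- by rewrite [RHS]ffunE !vf_bracketE opprB.
- rewrite [RHS]ffunE !vf_bracketE !actB !act_bracket.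
  set a := act X _; set b := act X _; set c := act Y _.
  ring.
Qed.
End VfLie.

(** * Soluble length of solvable algebras of formal vector fields *)

(** The coefficients are embedded into the field of fractions of the ring of
    power series; scalars act there through the constant series. *)
Lemma vf_solvable_bound (K : idomainType) n (g : set {ffun 'I_n -> fps K n}) N :
  (forall k, k.+1%:R != 0 :> K) -> lie_subalgebra (@vf_bracket K n) g ->
  derived_series (@vf_bracket K n) g N `<=` [set 0] ->
  derived_series (@vf_bracket K n) g (2 * n) `<=` [set 0].
Proof.
move=> char0.
pose frac (f : fps K n) : {fraction powser K n} := tofrac (f : powser K n).
pose D i := frac_d (@powser_d K n i).
have fracD : {morph frac : f h / f + h} by move=> f h; exact: (@tofracD (powser K n) f h).
have fracB : {morph frac : f h / f - h} by move=> f h; exact: (@tofracB (powser K n) f h).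
have actF (X : {ffun 'I_n -> fps K n}) f :
    frac (act X f) = vf_act D (\row_j frac (X j)) (frac f).
  rewrite /frac actE rmorph_sum; apply: eq_bigr => i _.
  rewrite /= tofracM mxE /D frac_d_tofrac //; exact: powser_dM.
apply: (derived_series_solvable_bound (@vf_lie_axioms K n)
   (D := D) _ _ _ (iota := fun c => frac (@powser_const K n c))
   (phi := fun X : {ffun 'I_n -> fps K n} => \row_j frac (X j))).
- move=> k; rewrite -(tofrac1 (powser K n)) -tofracMn tofrac_eq0.
  exact: powser_char0.
- by move=> i; apply: frac_dD; [exact: powser_dD|exact: powser_dM].
- by move=> i; apply: frac_dM; exact: powser_dM.
- by move=> X Y; apply/rowP => j; rewrite !mxE ffunE fracD.
- move=> c X; apply/rowP => j; rewrite !mxE ffunE powser_scaleE.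
  exact: tofracM.
- move=> X /rowP X0; apply/ffunP => j; have := X0 j; rewrite !mxE ffunE => /eqP.
  by rewrite tofrac_eq0 => /eqP.
- move=> X Y; apply/rowP => j; rewrite !mxE vf_bracketE.
  by rewrite [LHS]fracB !actF.
Qed.

Section SolubleLength.
Variables (C : nzRingType) (L : lmodType C) (br : L -> L -> L).
Implicit Types g : set L.

Lemma derived_series_eq0 g k : lie_subalgebra br g ->
  derived_series br g k `<=` [set 0] <-> derived_series br g k = [set 0].
Proof.
move=> gP; split=> [sub0|->//]; apply/seteqP; split=> // _ ->.
by case: (derived_series_subalgebra k gP).
Qed.

Lemma lie_solvableP g :
  lie_solvable br g <-> exists k, derived_series br g k = [set 0].
Proof.
rewrite /lie_solvable /soluble_length; case: pselect => [e|e].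
  split=> [_|_]; last by rewrite ltry.
  by case: e => k /asboolP gk; exists k.
split; first by rewrite ltxx.
by move=> [k gk]; case: e; exists k; apply/asboolP.
Qed.

Lemma soluble_length_le g k : derived_series br g k = [set 0] ->
  (soluble_length br g <= k%:Z%:E)%E.
Proof.
move=> gk; rewrite /soluble_length; case: pselect => [e|]; last first.
  by case; exists k; apply/asboolP.
by case: ex_minnP => m _ mmin; rewrite lee_fin lez_nat mmin //; apply/asboolP.
Qed.

Lemma soluble_length_eq g k : lie_subalgebra br g ->
  derived_series br g k.+1 = [set 0] -> derived_series br g k <> [set 0] ->
  soluble_length br g = k.+1%:Z%:E.
Proof.
move=> gP gk1 gk; rewrite /soluble_length; case: pselect => [e|]; last first.
  by case; exists k.+1; apply/asboolP.
case: ex_minnP => m /asboolP gm mmin; congr (_%:Z%:E).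
apply/eqP; rewrite eqn_leq mmin ?andTb; last exact/asboolP.
rewrite ltnNge; apply/negP => mk; apply: gk; apply/(derived_series_eq0 _ gP).
by apply: subset_trans (derived_series_decr gP mk) _; rewrite gm.
Qed.

End SolubleLength.

(** * Fields quadratic in each variable over the previous ones *)

Section Polynomials.
Variables (K : idomainType) (n : nat).
Implicit Types (f g : powser K n) (i j : 'I_n) (k : nat) (m : mono n).

(** Polynomials are used instead of convergent series as coefficients of the
    example: finiteness of the support makes stability under products and
    convergence immediate. *)
Definition is_poly f := finite_set [set m | (f : fps K n) m != 0].

Lemma is_poly_sub f (A : set (mono n)) : finite_set A ->
  (forall m, ~ A m -> (f : fps K n) m = 0) -> is_poly f.
Proof.
move=> finA fA; apply: sub_finite_set finA => m /=; apply: contraNP => /fA->.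
by rewrite eqxx.
Qed.

Lemma is_polyP f m : (~ [set m | (f : fps K n) m != 0] m) -> (f : fps K n) m = 0.
Proof. by move=> /negP/negPn/eqP. Qed.

Lemma is_poly0 : is_poly 0.
Proof. exact: (@is_poly_sub _ set0). Qed.

Lemma is_poly1 : is_poly 1.
Proof.
apply: (@is_poly_sub _ [set 0]) => // m m0.
rewrite -[LHS]/((m == 0)%:R : K); case: eqP => // mE; by case: m0.
Qed.

Lemma is_poly_var i : is_poly (powser_var K i).
Proof.
apply: (@is_poly_sub _ [set mono_var i]) => // m m0.
rewrite /powser_var; case: eqP => // mE; by case: m0.
Qed.

Lemma is_polyD f g : is_poly f -> is_poly g -> is_poly (f + g).
Proof.
move=> pf pg; have fin := conj pf pg; rewrite -finite_setU in fin.
apply: (is_poly_sub fin) => m.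
rewrite -[LHS]/((f : fps K n) m + (g : fps K n) m).
by move=> /not_orP[/is_polyP-> /is_polyP->]; rewrite addr0.
Qed.

Lemma is_polyM f g : is_poly f -> is_poly g -> is_poly (f * g).
Proof.
move=> pf pg.
have fin : finite_set [set p + q | p in [set m | (f : fps K n) m != 0]
    & q in [set m | (g : fps K n) m != 0]].
  exact: finite_image2.
apply: (is_poly_sub fin) => m mpq; rewrite -[LHS]/(fps_mul f g m) fps_mulE.
rewrite big_seq_cond big1 // => -[p q] /andP[]; rewrite mem_splits /= => /eqP pq _.
apply/eqP; rewrite mulf_eq0; apply/negPn/negP; rewrite negb_or => /andP[fp gq].
by apply: mpq; exists p => //; exists q.
Qed.

Lemma is_polyN f : is_poly f -> is_poly (- f).
Proof.
move=> pf; apply: (is_poly_sub pf) => m /is_polyP f0.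
by rewrite -[LHS]/(- (f : fps K n) m) f0 oppr0.
Qed.

Lemma is_poly_const c : is_poly (@powser_const K n c).
Proof.
apply: (is_poly_sub is_poly1) => m /is_polyP m0.
by rewrite -[LHS]/(c * (1 : powser K n) m) m0 mulr0.
Qed.

Lemma is_poly_d i f : is_poly f -> is_poly (powser_d i f).
Proof.
move=> pf.
have fin : finite_set [set ([ffun l => m l - mono_var i l]%N : mono n)
    | m in [set m | (f : fps K n) m != 0]].
  exact: finite_image.
apply: (is_poly_sub fin) => m mE; rewrite /powser_d /fps_partial.
rewrite (_ : f _ = 0) ?mul0rn //; apply: is_polyP => /= fm; apply: mE.
exists (m + mono_var i) => //; apply/ffunP => l; rewrite !ffunE.
exact: addnK.
Qed.

Lemma powser_var_neq0 i : powser_var K i != 0.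
Proof.
apply/eqP => /(congr1 (powser_d i)); rewrite powser_d_var powser_d0 eqxx.
by apply/eqP; rewrite oner_eq0.
Qed.

Lemma powser_coef0M f g :
  (f * g : powser K n) (0 : mono n) = (f : fps K n) 0 * (g : fps K n) 0.
Proof.
rewrite -[LHS]/(fps_mul f g 0) fps_mulE (big_rem (0, 0)) ?mem_splits ?addr0 //=.
rewrite big_seq_cond big1 ?addr0 // => -[p q].
rewrite mem_rem_uniq ?splits_uniq // inE mem_splits xpair_eqE /= andbT.
case/andP=> pq0 /eqP/ffunP pq; case/negP: pq0.
have pqi l : p l = 0%N /\ q l = 0%N.
  by have := pq l; rewrite !ffunE => /eqP; rewrite addn_eq0 => /andP[/eqP-> /eqP->].
by apply/andP; split; apply/eqP/ffunP => l; rewrite ffunE; case: (pqi l).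
Qed.

Lemma powser_var_coef0 i : (powser_var K i) (0 : mono n) = 0.
Proof.
rewrite /powser_var; case: eqP => // /ffunP/(_ i).
by rewrite !ffunE eqxx.
Qed.

(** In characteristic 0, the polynomials in the variables of index less than
    [k]. *)
Definition low (k : nat) f := is_poly f /\ forall i, (k <= i)%N -> powser_d i f = 0.

Lemma powser_d1 i : powser_d i (1 : powser K n) = 0.
Proof. exact: (derivation1 (powser_dM i)). Qed.

Lemma powser_dN i f : powser_d i (- f) = - powser_d i f.
Proof. by apply: (addrI (powser_d i f)); rewrite -powser_dD !subrr powser_d0. Qed.

Lemma low0 k : low k 0.
Proof. by split=> [|i _]; [exact: is_poly0|rewrite powser_d0]. Qed.

Lemma lowD k f g : low k f -> low k g -> low k (f + g).
Proof.
move=> [pf df] [pg dg]; split=> [|i ki]; first exact: is_polyD.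
by rewrite powser_dD df ?dg ?addr0.
Qed.

Lemma lowM k f g : low k f -> low k g -> low k (f * g).
Proof.
move=> [pf df] [pg dg]; split=> [|i ki]; first exact: is_polyM.
by rewrite powser_dM df ?dg // mul0r mulr0 addr0.
Qed.

Lemma lowN k f : low k f -> low k (- f).
Proof.
move=> [pf df]; split=> [|i ki]; first exact: is_polyN.
by rewrite powser_dN df ?oppr0.
Qed.

Lemma lowB k f g : low k f -> low k g -> low k (f - g).
Proof. by move=> lf lg; apply: lowD => //; exact: lowN. Qed.

Lemma low_const k c : low k (@powser_const K n c).
Proof. by split=> [|i _]; [exact: is_poly_const|rewrite powser_d_const]. Qed.

Lemma low_var (k : nat) i : (i < k)%N -> low k (powser_var K i).
Proof.
move=> ik; split=> [|l kl]; first exact: is_poly_var.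
rewrite powser_d_var; case: eqP => // li; move: kl; rewrite li leqNgt ik //.
Qed.

Lemma low_d k i f : low k f -> low k (powser_d i f).
Proof.
move=> [pf df]; split=> [|l kl]; first exact: is_poly_d.
by rewrite powser_dC df // powser_d0.
Qed.

Lemma low_le (k l : nat) f : (k <= l)%N -> low k f -> low l f.
Proof. by move=> kl [pf df]; split=> // i li; apply: df; exact: leq_trans li. Qed.

Lemma low_sum k (I : Type) (r : seq I) (F : I -> powser K n) :
  (forall x, low k (F x)) -> low k (\sum_(i <- r) F i).
Proof. by move=> lF; apply: big_ind => //; [exact: low0|exact: lowD]. Qed.

End Polynomials.

Section Example.
Variables (K : fieldType) (n : nat).
Local Notation vf := {ffun 'I_n -> fps K n}.
Local Notation br := (@vf_bracket K n).
Local Notation x_ := (@powser_var K n).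
Implicit Types (X Y : vf) (f h : powser K n) (i j k l : 'I_n).

Lemma act_var X i : act X (x_ i) = X i.
Proof.
rewrite actE (bigD1 i) //= powser_d_var eqxx mulr1 big1 ?addr0 // => l li.
by rewrite powser_d_var (negPf li) mulr0.
Qed.

Definition affine_vf : set vf := [set X | forall j, exists a b,
  [/\ low j a, low j b & X j = a * x_ j + b * x_ j ^+ 2]].

Lemma affine_low X i (k : nat) : affine_vf X -> (i < k)%N -> low k (X i : powser K n).
Proof.
move=> gX ik; have [a [b [la lb ->]]] := gX i.
have lv : low k (x_ i) by exact: low_var.
have la' : low k a by apply: low_le la; exact: ltnW.
have lb' : low k b by apply: low_le lb; exact: ltnW.
rewrite expr2; apply: lowD; first exact: lowM.
by apply: lowM => //; exact: lowM.
Qed.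

Lemma affine_act X k f : affine_vf X -> low k f -> low k (act X f).
Proof.
move=> gX lf; rewrite actE; apply: low_sum => i.
have [ki|ik] := leqP k i; first by rewrite lf.2 // mulr0; exact: low0.
by apply: lowM; [exact: affine_low|exact: low_d].
Qed.

(** The terms [a * c] of degree 1 and [b * d] of degree 3 in [x_ j] cancel, as
    in the Lie algebra spanned by x d/dx and x^2 d/dx. *)
Lemma affine_bracketE X Y j a b c d : X j = a * x_ j + b * x_ j ^+ 2 ->
  Y j = c * x_ j + d * x_ j ^+ 2 ->
  br X Y j = (act X c - act Y a) * x_ j
    + (act X d - act Y b + a * d - b * c) * x_ j ^+ 2 :> powser K n.
Proof.
move=> Xj Yj; rewrite vf_bracketE Xj Yj !actD !actM !act_var Xj Yj.
by ring.
Qed.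

Lemma affine_subalgebra : lie_subalgebra br affine_vf.
Proof.
split=> [j|X Y gX gY j|c X gX j|X Y gX gY j].
- exists 0, 0; split; rewrite ?ffunE ?mul0r ?addr0 //; exact: low0.
- have [a [b [la lb Xj]]] := gX j; have [c [d [lc ld Yj]]] := gY j.
  exists (a + c), (b + d); split; [exact: lowD|exact: lowD|].
  rewrite ffunE Xj Yj -[LHS]/((_ + _) + (_ + _) : powser K n); ring.
- have [a [b [la lb Xj]]] := gX j; pose e := @powser_const K n c.
  exists (e * a), (e * b); split; try by apply: lowM => //; exact: low_const.
  by rewrite ffunE powser_scaleE Xj mulrDr !mulrA.
- have [a [b [la lb Xj]]] := gX j; have [c [d [lc ld Yj]]] := gY j.
  exists (act X c - act Y a), (act X d - act Y b + a * d - b * c).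
  split; last exact: affine_bracketE.
    by apply: lowB; exact: affine_act.
  apply: lowB; last exact: lowM.
  apply: lowD; last exact: lowM.
  by apply: lowB; exact: affine_act.
Qed.

(** With [affine_quad], the two layers through which the derived series moves
    past one variable: the quotient of [affine_from j] by [affine_quad j] is
    spanned by multiples of [x_ j] d/dx_j, and that of [affine_quad j] by
    [affine_from j.+1] by multiples of [x_ j ^+ 2] d/dx_j. *)
Definition affine_from (j : nat) : set vf :=
  [set X | affine_vf X /\ forall i, (i < j)%N -> X i = 0].

Definition affine_quad (j : 'I_n) : set vf :=
  [set X | affine_from j X /\ exists2 b, low j b & X j = b * x_ j ^+ 2].

Lemma affine_from_subalgebra (j : nat) : lie_subalgebra br (affine_from j).
Proof.
have [g0 gD gZ gB] := affine_subalgebra.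
split=> [|X Y [gX X0] [gY Y0]|c X [gX X0]|X Y [gX X0] [gY Y0]].
- by split=> // i _; rewrite ffunE.
- by split=> [|i ij]; [exact: gD|rewrite ffunE X0 ?Y0 ?addr0].
- by split=> [|i ij]; [exact: gZ|rewrite ffunE X0 ?scaler0].
- split=> [|i ij]; first exact: gB.
  by rewrite vf_bracketE X0 ?Y0 // !act0 subr0.
Qed.

Lemma affine_from_act X (j : 'I_n) f : affine_from j X -> low j f -> act X f = 0.
Proof.
move=> [_ X0] [_ df]; rewrite actE big1 // => i _.
have [ij|ji] := ltnP i j; first by rewrite X0 // mul0r.
by rewrite df // mulr0.
Qed.

Lemma affine_from_bracket X Y (j : 'I_n) :
  affine_from j X -> affine_from j Y -> affine_quad j (br X Y).
Proof.
move=> hX hY; split; first by case: (affine_from_subalgebra j) => _ _ _; apply.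
have [a [b [la lb Xj]]] := hX.1 j; have [c [d [lc ld Yj]]] := hY.1 j.
exists (a * d - b * c); first by apply: lowB; exact: lowM.
have := affine_bracketE Xj Yj => ->.
rewrite !(affine_from_act hX) // !(affine_from_act hY) //.
by rewrite !subrr mul0r !add0r.
Qed.

Lemma affine_quad_subalgebra j : lie_subalgebra br (affine_quad j).
Proof.
have [h0 hD hZ hB] := affine_from_subalgebra j.
split=> [|X Y [hX [b lb Xj]] [hY [d ld Yj]]|c X [hX [b lb Xj]]|X Y [hX _] [hY _]].
- by split=> //; exists 0; [exact: low0|rewrite ffunE mul0r].
- split; first exact: hD.
  exists (b + d); first exact: lowD.
  by rewrite ffunE Xj Yj mulrDl.
- split; first exact: hZ.
  exists (@powser_const K n c * b); first by apply: lowM => //; exact: low_const.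
  by rewrite ffunE powser_scaleE Xj mulrA.
- exact: affine_from_bracket.
Qed.

Lemma affine_quad_bracket X Y (j : 'I_n) :
  affine_quad j X -> affine_quad j Y -> affine_from j.+1 (br X Y).
Proof.
move=> [hX [b lb Xj]] [hY [d ld Yj]].
have [hB h0] : affine_from j (br X Y).
  by case: (affine_from_subalgebra j) => _ _ _; apply.
split=> // i; rewrite ltnS leq_eqVlt => /predU1P[/val_inj->|]; last exact: h0.
have Xj' : X j = 0 * x_ j + b * x_ j ^+ 2 by rewrite mul0r add0r.
have Yj' : Y j = 0 * x_ j + d * x_ j ^+ 2 by rewrite mul0r add0r.
have := affine_bracketE Xj' Yj' => ->.
rewrite !(affine_from_act hX) ?(affine_from_act hY) //; try exact: low0.
by rewrite !subrr !mul0r mulr0 !add0r oppr0 mul0r.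
Qed.

Lemma affine_derived (j : nat) : (j <= n)%N ->
  derived_series br affine_vf (2 * j) `<=` affine_from j.
Proof.
elim: j => [_ X gX|j IHj jn]; first by split.
rewrite mulnS add2n; pose oj := Ordinal jn.
have d1 : derived_series br affine_vf (2 * j).+1 `<=` affine_quad oj.
  apply: derived_seriesS_min => [|X Y dX dY]; first exact: affine_quad_subalgebra.
  by apply: affine_from_bracket; apply: (IHj (ltnW jn)).
apply: derived_seriesS_min => [|X Y /d1 dX /d1 dY].
  exact: affine_from_subalgebra.
exact: (affine_quad_bracket dX dY).
Qed.

Lemma affine_solvable : derived_series br affine_vf (2 * n) `<=` [set 0].
Proof.
move=> X /(affine_derived (leqnn n))[_ X0]; apply/ffunP => i.
by rewrite ffunE X0.
Qed.

End Example.

(** * Nonvanishing of the derived series of the example *)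

Section ExampleLength.
Variables (K : fieldType) (n : nat).
Hypothesis char0 : forall k, k.+1%:R != 0 :> K.
Local Notation vf := {ffun 'I_n -> fps K n}.
Local Notation br := (@vf_bracket K n).
Local Notation x_ := (@powser_var K n).
Local Notation d_ := (@powser_d K n).
Local Notation g_ := (derived_series br (@affine_vf K n)).
Implicit Types (f h : powser K n) (i j k l : 'I_n) (m p : 'I_n -> nat).

Definition monom m : powser K n := \prod_i x_ i ^+ m i.

Lemma monomM m p : monom m * monom p = monom (fun i => m i + p i)%N.
Proof. by rewrite /monom -big_split; apply: eq_bigr => i _; rewrite exprD. Qed.

Lemma eq_monom m p : m =1 p -> monom m = monom p.
Proof. by move=> mp; apply: eq_bigr => i _; rewrite mp. Qed.

Lemma monom_delta j : monom (fun i => i == j) = x_ j.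
Proof.
rewrite /monom (bigD1 j) //= eqxx expr1 big1 ?mulr1 // => i ij.
by rewrite (negPf ij) expr0.
Qed.

Lemma monom_neq0 m : monom m != 0.
Proof. by apply/prodf_neq0 => i _; rewrite expf_neq0 ?powser_var_neq0. Qed.

(** Multiplying by the variable avoids lowering an exponent, and with it the
    case of exponent zero. *)
Lemma euler_monom j m : x_ j * d_ j (monom m) = (m j)%:R * monom m.
Proof.
have -> : m j = (\sum_i (i == j) * m i)%N.
  rewrite (bigD1 j) //= eqxx mul1n big1 ?addn0 // => i ij.
  by rewrite (negPf ij).
have E i a : x_ j * d_ j (x_ i ^+ a) = ((i == j) * a)%:R * x_ i ^+ a.
  elim: a => [|a IHa]; first by rewrite powser_d1 muln0 mulr0 mul0r.
  rewrite exprS powser_dM mulrDr [X in _ + X]mulrCA IHa powser_d_var eq_sym.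
  have [->|_] := eqVneq i j; last by rewrite !mul0n !mul0r !mulr0 addr0.
  by rewrite !mul1n mul1r -natr1; ring.
rewrite /monom; elim/big_rec2: _ => [|i c f _ IHf].
  by rewrite powser_d1 mulr0 mul0r.
by rewrite powser_dM mulrDr mulrA E [X in _ + X]mulrCA IHf natrD; ring.
Qed.

Lemma monom_d0 j m : m j = 0%N -> d_ j (monom m) = 0.
Proof.
move=> mj; apply/eqP; have := euler_monom j m; rewrite mj mul0r => /eqP.
by rewrite mulf_eq0 (negPf (powser_var_neq0 K j)).
Qed.

Lemma monom_low (k : nat) m : (forall i, (k <= i)%N -> m i = 0%N) -> low k (monom m).
Proof.
move=> m0; split=> [|i ki]; last by rewrite monom_d0 ?m0.
rewrite /monom; apply: big_ind => [||i _]; [exact: is_poly1|exact: is_polyM|].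
elim: (m i) => [|a IHa]; first exact: is_poly1.
by rewrite exprS; apply: is_polyM => //; exact: is_poly_var.
Qed.

Definition single k f : vf := [ffun i => if i == k then (f : fps K n) else 0].

Lemma act_single k f h : act (single k f) h = f * d_ k h.
Proof.
rewrite actE (bigD1 k) //= ffunE eqxx big1 ?addr0 // => i ik.
by rewrite ffunE (negPf ik) mul0r.
Qed.

Lemma single_bracket_lt j k f h : j != k -> d_ k f = 0 ->
  br (single j f) (single k h) = single k (f * d_ j h).
Proof.
move=> jk df; apply/ffunP => i; rewrite vf_bracketE !act_single !ffunE.
have [->|ik] := eqVneq i k.
  by rewrite eq_sym (negPf jk) powser_d0 mulr0 subr0.
rewrite powser_d0 mulr0 sub0r; case: eqP => _; first by rewrite df mulr0 oppr0.
by rewrite powser_d0 mulr0 oppr0.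
Qed.

Lemma single_bracket_eq k f h :
  br (single k f) (single k h) = single k (f * d_ k h - h * d_ k f).
Proof.
apply/ffunP => i; rewrite vf_bracketE !act_single !ffunE.
by case: eqP => // _; rewrite !powser_d0 !mulr0 subrr.
Qed.

Lemma single_natmul k (a : nat) f : single k (a%:R * f) = a%:R *: single k f.
Proof.
apply/ffunP => i; rewrite [RHS]ffunE !ffunE; case: eqP => _; last by rewrite scaler0.
by rewrite scaler_nat mulr_natl.
Qed.

Lemma monom_shift m p : (forall i, p i <= m i)%N ->
  monom m = monom p * monom (fun i => m i - p i)%N.
Proof. by move=> pm; rewrite monomM; apply: eq_monom => i; rewrite subnKC. Qed.

(** The exponents of the monomials x^m for which x^m d/dx_k is shown to
    survive: the bound [N] on the lower exponents grows along the derived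
    series, but only finitely. *)
Definition tail_monom (N : nat) k m :=
  [/\ m k = 1 \/ m k = 2, forall i, (i < k)%N -> (N <= m i)%N
    & forall i, (k < i)%N -> m i = 0]%N.

(** Bracketing x^p x_j d/dx_j with x^m' d/dx_k multiplies the latter by
    m'_j x^p; a target exponent [m] is reached from [m' = m - p], which still
    has large exponents if those of [m] are large enough. *)
Lemma derived_monom_step r (N q s : nat) j :
  let p i := (if (i < j)%N then q else if i == j then s else 0)%N in
  g_ r (single j (monom (fun i => p i + (i == j))%N)) ->
  (forall k m, (j < k)%N -> tail_monom N k m -> g_ r (single k (monom m))) ->
  forall k m, (j < k)%N -> tail_monom (N + q + s).+1 k m ->
    g_ r.+1 (single k (monom m)).
Proof.
move=> p gp gm k m jk [mk m_ge m0].
have ple i : (i <= j)%N -> (p i <= q + s)%N.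
  by rewrite /p; case: ltnP => [_ _|_ _]; [|case: eqP => _]; lia.
have p0 i : (j < i)%N -> p i = 0%N.
  move=> ji; rewrite /p ltnNge (ltnW ji) /=; case: eqP => // ij.
  by rewrite ij ltnn in ji.
pose m' i := (m i - p i)%N.
have mE : monom m = monom p * monom m'.
  apply: monom_shift => i; have [ij|ji] := leqP i j; last by rewrite p0.
  by have := ple i ij; have := m_ge i (leq_ltn_trans ij jk); lia.
have m'j : (0 < m' j)%N.
  by have := ple j (leqnn j); have := m_ge j jk; rewrite /m'; lia.
have gm' : g_ r (single k (monom m')).
  apply: gm => //; split=> [|i ik|i ki]; rewrite /m'.
  - by rewrite p0 // subn0.
  - have := m_ge i ik; have [ij|ji] := leqP i j; last by rewrite (p0 _ ji); lia.
    by have := ple i ij; lia.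
  - by rewrite m0.
have := derived_series_bracket gp gm'.
rewrite single_bracket_lt.
- rewrite -monomM monom_delta -mulrA euler_monom mulrCA -mE single_natmul.
  have [_ _ gZ _] := derived_series_subalgebra r.+1 (affine_subalgebra K n).
  move=> /(gZ (m' j)%:R^-1); rewrite scalerA mulVf ?scale1r //.
  by case: (m' j) m'j.
- by apply/eqP => jk'; rewrite jk' ltnn in jk.
- by apply: monom_d0; rewrite p0 // -val_eqE gtn_eqF.
Qed.

(** The bracket of x^p x_j d/dx_j and x^q x_j^2 d/dx_j, with [p] and [q]
    supported in the variables before [j], is x^(p+q) x_j^2 d/dx_j. *)
Lemma derived_monom_quad r (N : nat) j :
  (forall m, tail_monom N j m -> g_ r (single j (monom m))) ->
  g_ r.+1 (single j (monom (fun i => (if (i < j)%N then N.*2.+1 else 0) + (i == j).*2)%N)).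
Proof.
move=> gm.
pose p (M a : nat) i := ((if (i < j)%N then M else 0) + (i == j) * a)%N.
have pj M a : p M a j = a by rewrite /p ltnn eqxx mul1n.
have gp M a : (a = 1 \/ a = 2)%N -> (N <= M)%N -> g_ r (single j (monom (p M a))).
  move=> a12 NM; apply: gm; split=> [|i ij|i ji]; rewrite ?pj // /p.
    by rewrite ij; lia.
  by rewrite ltnNge (ltnW ji) -val_eqE gtn_eqF.
have := derived_series_bracket (gp N 1 (or_introl erefl) (leqnn N))
  (gp N.+1 2 (or_intror erefl) (leqnSn N)).
rewrite single_bracket_eq.
have pS M a : monom (p M a.+1) = monom (p M a) * x_ j.
  rewrite -(monom_delta j) monomM; apply: eq_monom => i; rewrite /p; lia.
have E M a M' a' : monom (p M a.+1) * d_ j (monom (p M' a')) =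
    a'%:R * monom (p (M + M') (a + a'))%N.
  rewrite pS -mulrA euler_monom pj mulrCA monomM; congr (_ * _).
  apply: eq_monom => i; rewrite /p; case: ifP => _; lia.
rewrite !E (addSnnS N) -mulrBl -natrB // mul1r; congr (g_ _ (single _ _)).
by apply: eq_monom => i; rewrite /p; case: ifP => _; lia.
Qed.

(** Two steps for one variable: x_j d/dx_j acts first and is lost, then
    x_j^2 d/dx_j acts. *)
Lemma derived_monom (j : nat) : (j <= n)%N -> exists N, forall k m,
  (j <= k)%N -> tail_monom N k m -> g_ (2 * j) (single k (monom m)).
Proof.
elim: j => [_|j IHj jn].
  exists 0%N => k m _ [mk _ m0] i; rewrite ffunE.
  case: eqP => [->|_]; last first.
    by exists 0, 0; split; rewrite ?mul0r ?addr0 //; exact: low0.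
  pose m' l := if l == k then 0%N else m l.
  have m'low : low k (monom m').
    apply: monom_low => l; rewrite /m' leq_eqVlt => /predU1P[/val_inj->|kl].
      by rewrite eqxx.
    by rewrite m0 // if_same.
  have mE : monom m = monom m' * x_ k ^+ m k.
    rewrite /monom (bigD1 k) // [in RHS](bigD1 k) //= /m' eqxx expr0 mul1r mulrC.
    by congr (_ * _); apply: eq_bigr => l lk; rewrite (negPf lk).
  rewrite mE; case: mk => ->.
    by exists (monom m'), 0; split; rewrite ?mul0r ?addr0 //; exact: low0.
  by exists 0, (monom m'); split; rewrite ?mul0r ?add0r //; exact: low0.
have [N gN] := IHj (ltnW jn); pose oj := Ordinal jn.
have g1 := derived_monom_quad (fun m => gN oj m (leqnn j)).
have gN1 : forall k m, (oj < k)%N -> tail_monom (N + N + 0).+1 k m ->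
    g_ (2 * j).+1 (single k (monom m)).
  apply: derived_monom_step => [|k m jk]; last exact: gN (ltnW jk).
  apply: gN => //; split=> [|i ij|i ji]; rewrite /=.
  - by left; rewrite ltnn eqxx.
  - by rewrite ij leq_addr.
  - by rewrite ltnNge (ltnW ji) -val_eqE gtn_eqF.
exists ((N + N + 0).+1 + N.*2.+1 + 1).+1 => k m jk.
rewrite mulnS add2n; apply: (derived_monom_step _ gN1 jk).
rewrite (eq_monom (p := fun i => ((if (i < j)%N then N.*2.+1 else 0) + (i == oj).*2)%N)) //.
move=> i /=; case: ifP => [ij|_]; case: eqP => [iE|_] //=.
by rewrite iE ltnn in ij.
Qed.

Lemma affine_derived_neq0 (hn : (0 < n)%N) : g_ (2 * n).-1 <> [set 0].
Proof.
have jn : (n.-1 < n)%N by rewrite prednK.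
have [N gN] := derived_monom (ltnW jn); pose oj := Ordinal jn.
have := derived_monom_quad (fun m => gN oj m (leqnn _)).
rewrite (_ : (2 * n.-1).+1 = (2 * n).-1) => [gm gE|]; last by lia.
rewrite gE in gm; move: gm => /ffunP/(_ oj); rewrite !ffunE eqxx => /eqP.
exact/negP/monom_neq0.
Qed.

End ExampleLength.

(** * Convergence and conclusion *)

Lemma is_poly_convergent (R : realType) n (f : powser R[i] n) :
  is_poly f -> fps_convergent f.
Proof.
move=> pf; exists 1 => // x _; rewrite /summable.
pose A := [set m : mono n | (f : fps R[i] n) m != 0].
pose a (m : mono n) : R := Normc.normc ((f : fps R[i] n) m * \prod_(i < n) x i ^+ m i).
rewrite (_ : esum _ _ = \esum_(m in A) `|a m|%:E); last first.
  rewrite [RHS]esum_mkcond; apply: eq_esum => m _ /=.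
  case: ifPn => // /negP; rewrite inE => /is_polyP ->.
  by rewrite mul0r Normc.normc0 normr0.
rewrite esum_fset // fsbig_finite // sumEFin; exact: ltry.
Qed.

Lemma complex_char0 (R : realType) k : k.+1%:R != 0 :> R[i].
Proof. by rewrite pnatr_eq0. Qed.

Theorem theorem1p3 (R : realType) (n : nat) (hn : (1 <= n)%N) :
  (forall g : set {ffun 'I_n -> fps R[i] n},
     g `<=` @formal_singular_vf R[i] n ->
     lie_subalgebra (@vf_bracket R[i] n) g ->
     lie_solvable (@vf_bracket R[i] n) g ->
     (soluble_length (@vf_bracket R[i] n) g <= (2 * n)%N%:Z%:E)%E)
  /\
  (exists g : set {ffun 'I_n -> fps R[i] n},
     [/\ g `<=` @convergent_singular_vf R n,
         lie_subalgebra (@vf_bracket R[i] n) g,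
         lie_solvable (@vf_bracket R[i] n) g
       & soluble_length (@vf_bracket R[i] n) g = (2 * n)%N%:Z%:E]).
Proof.
split=> [g _ gP /lie_solvableP[N gN]|].
  apply/soluble_length_le/(derived_series_eq0 _ gP).
  by apply: (vf_solvable_bound (N := N) (@complex_char0 R) gP); rewrite gN.
have gP := affine_subalgebra R[i] n.
have g0 : derived_series (@vf_bracket R[i] n) (affine_vf (n := n)) (2 * n) = [set 0].
  by apply/(derived_series_eq0 _ gP); exact: affine_solvable.
exists (@affine_vf R[i] n); split=> //.
- move=> X gX; split=> j; last first.
    by apply: is_poly_convergent; case: (affine_low gX (ltnSn j)).
  have [a [b [_ _ Xj]]] := gX j; rewrite /fps_maxideal /= Xj.
  rewrite -[LHS]/((a * _ : powser _ n) 0 + (b * _ : powser _ n) 0).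
  by rewrite expr2 !powser_coef0M powser_var_coef0 !mulr0 addr0.
- by apply/lie_solvableP; exists (2 * n)%N.
- have nE : (2 * n = (2 * n).-1.+1)%N by lia.
  rewrite nE; apply: soluble_length_eq => //; first by rewrite -nE.
  by apply: affine_derived_neq0 => //; exact: complex_char0.
Qed.
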